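(* There exists a convergent Turing machine which is universal for the class of convergent Turing machines; furthermore, this machine can be chosen to be a tuatara machine.
   Context: Turing machines map binary strings to binary strings (partial functions on $\Sigma^*$, $\Sigma=\{0,1\}$); $\mathrm{dom}(M)$ is the set of inputs on which $M$ halts. $\mathrm{bin}:\mathbf{N}=\{1,2,\dots\}\to\Sigma^*$ is the bijection sending $n$ to its binary expansion with the leading 1 removed. $\zeta_M=\sum_{n\ge1,\ \mathrm{bin}(n)\in\mathrm{dom}(M)}\frac1n$; $M$ is convergent if $\zeta_M<\infty$ and a tuatara machine if $\zeta_M\le1$. A Turing machine $W$ is universal for a class $\Re$ of Turing machines if for every $C\in\Re$ there is a constant $c\ge0$ such that for every $x\in\mathrm{dom}(C)$ there is $p_x\in\mathrm{dom}(W)$ with $|p_x|\le|x|+c$ and $W(p_x)=C(x)$. *)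

(* Defs.v *)
From HB Require Import structures.
From mathcomp Require Import all_boot all_order all_algebra.
From mathcomp Require Import all_classical all_reals all_analysis.
Set Implicit Arguments.
Unset Strict Implicit.
Unset Printing Implicit Defensive.
Import Order.TTheory GRing.Theory Num.Theory.

Local Open Scope classical_set_scope.
Local Open Scope ring_scope.

(* Binary strings are [seq bool], with [true] for 1 and [false] for 0.        *)

(* Deterministic Turing machines with one two-way infinite tape, a finite set *)
(* of states and a finite alphabet.  Besides the bits [Some (inl b)] and the  *)
(* blank [None], a machine has auxiliary symbols [Some (inr a)] of its choice.*)

Inductive direction := Left | Stay | Right.

(* [None] as the value of the transition function means that M halts.         *)
Record turing_machine := TuringMachine {
  state : finType;
  aux : finType;
  start : state;
  trans : state -> option (bool + aux) ->
          option (state * option (bool + aux) * direction)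
}.

Definition cell (M : turing_machine) := option (bool + aux M).

(* [lcells] is listed outwards from the head, nearest cell first, and so is   *)
(* [rcells]; all the cells beyond the two lists are blank.                    *)
Record config (M : turing_machine) := Config {
  cstate : state M;
  lcells : seq (cell M);
  hcell : cell M;
  rcells : seq (cell M)
}.

Definition move (M : turing_machine) (q : state M) (l : seq (cell M))
    (s : cell M) (r : seq (cell M)) (d : direction) : config M :=
  match d with
  | Left => Config q (behead l) (head None l) (s :: r)
  | Stay => Config q l s r
  | Right => Config q (s :: l) (head None r) (behead r)
  end.

Definition step (M : turing_machine) (k : config M) : option (config M) :=
  if trans (cstate k) (hcell k) is Some (q, s, d)
  then Some (move q (lcells k) s (rcells k) d) else None.

(* The head starts on the first bit of the input.                             *)
Definition init (M : turing_machine) (x : seq bool) : config M :=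
  let t : seq (cell M) := [seq Some (inl b) | b <- x] in
  Config (start M) [::] (head None t) (behead t).

(* The halting configuration reached from [k] in at most [n] steps, if any.   *)
Fixpoint run (M : turing_machine) (n : nat) (k : config M) :
    option (config M) :=
  match step k, n with
  | None, _ => Some k
  | Some _, 0%N => None
  | Some k', m.+1 => run m k'
  end.

Fixpoint leading_bits (A : Type) (t : seq (option (bool + A))) : seq bool :=
  if t is Some (inl b) :: t' then b :: leading_bits t' else [::].

(* The longest block of bits starting under the head and extending right.     *)
Definition output (M : turing_machine) (k : config M) : seq bool :=
  leading_bits (hcell k :: rcells k).

(* The graph of the partial function of M: M halts on x with output y.        *)
Definition computes (M : turing_machine) (x y : seq bool) : Prop :=
  exists n k, run n (init M x) = Some k /\ output k = y.

Definition dom (M : turing_machine) : set (seq bool) :=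
  [set x | exists n k, run n (init M x) = Some k].

(* The binary expansion of n, most significant digit first, has digits        *)
(* n / 2^i mod 2 for i = trunc_log 2 n, ..., 0; the first one is dropped.     *)
(* Only meaningful for n >= 1.                                                *)
Definition bin (n : nat) : seq bool :=
  [seq odd (n %/ 2 ^ i) | i <- rev (iota 0 (trunc_log 2 n))].

Definition zeta (R : realType) (M : turing_machine) : \bar R :=
  (\sum_(1 <= n <oo | bin n \in dom M) (n%:R^-1)%:E)%E.

Definition convergent (R : realType) (M : turing_machine) : Prop :=
  (zeta R M < +oo)%E.

Definition tuatara (R : realType) (M : turing_machine) : Prop :=
  (zeta R M <= 1)%E.

Definition universal_for (P : turing_machine -> Prop) (W : turing_machine) :
    Prop :=
  forall C, P C -> exists c : nat, forall x, x \in dom C ->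
    exists p, [/\ p \in dom W, (size p <= size x + c)%N &
                  exists y, computes C x y /\ computes W p y].

(* Main.v *)
Require Import Defs.
From mathcomp Require Import all_boot all_order all_algebra.
From mathcomp Require Import all_classical all_reals all_analysis.
From mathcomp Require Import zify ring.
From HB Require Import structures.
Set Implicit Arguments.
Unset Strict Implicit.
Unset Printing Implicit Defensive.
Import Order.TTheory GRing.Theory Num.Theory.

(* The word bin n with n = 2^i (2m+1) is bin m followed by 1 0^i.  On it the  *)
(* universal machine W runs machine number i on bin m, but releases the       *)
(* result only at a stage t at which the inputs j < t accepted within t steps *)
(* by machine i, m being one of them, satisfy sum 1/j <= i.  Hence the inputs *)
(* of W with index i contribute at most i/2^(i+1) to zeta W, and these bounds *)
(* sum to 1.  Padding gives every machine arbitrarily large numbers i, so the *)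
(* condition never blocks a convergent machine.  W itself is obtained by      *)
(* compiling a program for counters; the counters are kept on the tape, to    *)
(* the left of the input, as the numbers of occurrences of marks.             *)

(** * Binary words and counter programs *)

(** Every n > 0 is 2^i (2m+1) for one pair (i, m), and 1/n is less than 1/(2^(i+1) m) when m > 0.
    For a fixed i and finitely many accepted arguments m, there is one stage at which machine i has
    halted on all of them and the release condition holds ([uaccepts_stage]), so the sum of their
    reciprocals is at most i ([accepted_index_sum]). Since the series of i/2^(i+1) has sum 1, zeta
    of W is at most 1 ([accepted_sum]).

    Conversely, a convergent C has a padded code e that is at least zeta of C. The sums tested by W
    are then partial sums of zeta of C and never exceed e, so every halting computation of C is
    eventually released. The word x is answered on x followed by 1 0^e, at the cost of e+1 bits.

    That W is a Turing machine is shown in layers. Structured counter programs compile to code with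
    jumps ([code_exec]), which a Turing machine simulates instruction by instruction
    ([step_simulated]). Functions built by iteration are [computable] by counter programs, among
    them the simulation of any coded machine for t steps ([run_coded]). [universal_program] searches
    for the first accepting stage and emits the result found there. *)

Definition num (w : seq bool) : nat := foldl (fun n (b : bool) => n.*2 + b) 1 w.

Lemma num_rcons w b : num (rcons w b) = (num w).*2 + b.
Proof. by rewrite /num foldl_rcons. Qed.

Lemma num_gt0 w : 0 < num w.
Proof. by elim/last_ind: w => // w b IH; rewrite num_rcons; lia. Qed.

Lemma bin_double_add n (b : bool) : 0 < n -> bin (n.*2 + b) = rcons (bin n) b.
Proof.
move=> n0.
have h k : (n.*2 + b) %/ 2 ^ k.+1 = n %/ 2 ^ k.
  rewrite expnS divnMA.
  by congr divn; rewrite -muln2 divnMDl //; case: b; rewrite addn0.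
have e : trunc_log 2 (n.*2 + b) = (trunc_log 2 n).+1.
  have /andP[h1 h2] := @trunc_log_bounds 2 n isT n0.
  by apply: trunc_log_eq => //; rewrite !expnS in h2 *; case: b {h}; lia.
rewrite /bin e /= rev_cons map_rcons divn1 oddD odd_double oddb addFb.
congr rcons.
rewrite -[1]/(1 + 0) iotaDl -map_rev -map_comp.
by apply: eq_map => i /=; rewrite add1n h.
Qed.

Lemma numK w : bin (num w) = w.
Proof.
elim/last_ind: w => [|w b IH] //.
by rewrite num_rcons bin_double_add ?num_gt0 // IH.
Qed.

Lemma binK n : 0 < n -> num (bin n) = n.
Proof.
elim/ltn_ind: n => n IH n0.
case: (leqP n 1) => n1; first by have -> : n = 1 by lia.
have e : n = (n./2).*2 + odd n by rewrite addnC odd_double_half.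
rewrite [in LHS]e bin_double_add ?num_rcons ?IH -?e //; lia.
Qed.

Definition env := nat -> nat.
Definition upd (r : env) (i x : nat) : env :=
  fun j => if j == i then x else r j.

(* [While i c] and [Input i c] decrement counter [i], respectively add the    *)
(* next input bit to it, before each execution of [c].                        *)
Inductive cmd :=
| Skip
| Inc of nat
| Dec of nat
| Emit of bool
| Seq of cmd & cmd
| While of nat & cmd
| Input of nat & cmd.

(* The counters, the unread input, and the output.                            *)
Definition store : Type := env * seq bool * seq bool.

(** On the tape, emitting a bit overwrites the home cell, and the emitted bits have to stay
    contiguous. Hence [Emit] requires the input to be exhausted, and [Input] reads a bit only while
    the output is empty. *)
Inductive exec : cmd -> store -> store -> Prop :=
| XSkip s : exec Skip s s
| XInc i r p o : exec (Inc i) (r, p, o) (upd r i (r i).+1, p, o)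
| XDec i r p o : exec (Dec i) (r, p, o) (upd r i (r i).-1, p, o)
| XEmit b r o : exec (Emit b) (r, [::], o) (r, [::], rcons o b)
| XSeq c d s t u : exec c s t -> exec d t u -> exec (Seq c d) s u
| XWhile0 i c r p o : r i = 0 -> exec (While i c) (r, p, o) (r, p, o)
| XWhileS i c r p o s t : r i != 0 -> exec c (upd r i (r i).-1, p, o) s ->
    exec (While i c) s t -> exec (While i c) (r, p, o) t
| XInput0 i c r o : exec (Input i c) (r, [::], o) (r, [::], o)
| XInputS i c r (b : bool) p s t : exec c (upd r i (r i + b), p, [::]) s ->
    exec (Input i c) s t -> exec (Input i c) (r, b :: p, [::]) t.

(* The second argument of [IDec] and [IRead] is the address of the jump taken *)
(* when the counter is 0, respectively when the input is exhausted.           *)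
Inductive instr :=
| IInc of nat
| IDec of nat & nat
| IEmit of bool
| IRead of nat & nat
| IJmp of nat.

Definition cstep (P : seq instr) (k : nat * store) : option (nat * store) :=
  let: (pc, (r, p, o)) := k in
  match onth P pc with
  | None => None
  | Some (IInc i) => Some (pc.+1, (upd r i (r i).+1, p, o))
  | Some (IDec i a) =>
      if r i == 0 then Some (a, (r, p, o))
      else Some (pc.+1, (upd r i (r i).-1, p, o))
  | Some (IEmit b) =>
      if p is [::] then Some (pc.+1, (r, [::], rcons o b)) else None
  | Some (IRead i a) =>
      match p, o with
      | [::], _ => Some (a, (r, [::], o))
      | b :: p', [::] => Some (pc.+1, (upd r i (r i + b), p', [::]))
      | _, _ => None
      end
  | Some (IJmp a) => Some (a, (r, p, o))
  end.

Fixpoint nsteps (A : Type) (f : A -> option A) (n : nat) (a b : A) : Prop :=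
  if n is m.+1 then exists2 a', f a = Some a' & nsteps f m a' b else a = b.

Lemma nsteps_trans (A : Type) (f : A -> option A) m n a b c :
  nsteps f m a b -> nsteps f n b c -> nsteps f (m + n) a c.
Proof.
elim: m a => [|m IH] a /=; first by move=> ->.
by case=> a' fa h1 h2; exists a' => //; apply: IH h1 h2.
Qed.

(** Jumps are absolute, so [o] is the address where the code is placed. For [Dec] both outcomes of
    the test lead to the next address, so that decrementing 0 has no effect. *)
Fixpoint code (o : nat) (c : cmd) : seq instr :=
  match c with
  | Skip => [::]
  | Inc i => [:: IInc i]
  | Dec i => [:: IDec i o.+1]
  | Emit b => [:: IEmit b]
  | Seq c d => let p := code o c in p ++ code (o + size p) d
  | While i c => let p := code o.+1 c in
      IDec i (o + size p).+2 :: rcons p (IJmp o)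
  | Input i c => let p := code o.+1 c in
      IRead i (o + size p).+2 :: rcons p (IJmp o)
  end.

Definition code_at (P : seq instr) (o : nat) (p : seq instr) :=
  forall j, j < size p -> onth P (o + j) = onth p j.

Lemma onth_cat (T : Type) (s t : seq T) j :
  onth (s ++ t) j = if j < size s then onth s j else onth t (j - size s).
Proof. by elim: s j => [|x s IH] [|j] //=; rewrite IH ltnS. Qed.

Lemma code_at_cat P o p q :
  code_at P o (p ++ q) -> code_at P o p /\ code_at P (o + size p) q.
Proof.
move=> h; split=> j hj.
  by rewrite h ?onth_cat ?hj // size_cat ltn_addr.
rewrite -addnA h ?size_cat ?ltn_add2l // onth_cat.
by rewrite ltnNge leq_addr /= addKn.
Qed.

Lemma code_at_loop P o i p k :
  code_at P o (i :: rcons p k) ->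
  [/\ onth P o = Some i, code_at P o.+1 p & onth P (o + size p).+1 = Some k].
Proof.
rewrite -cats1 -cat1s => /code_at_cat[h /code_at_cat[h1 h2]].
have := h 0 isT; have := h2 0 isT.
by rewrite !addn0 addn1 addSn in h1 *.
Qed.

Lemma code_at_while P o i c : code_at P o (code o (While i c)) ->
  [/\ onth P o = Some (IDec i (o + size (code o.+1 c)).+2),
      code_at P o.+1 (code o.+1 c)
    & onth P (o + size (code o.+1 c)).+1 = Some (IJmp o)].
Proof. by move=> /= /code_at_loop. Qed.

Lemma code_at_input P o i c : code_at P o (code o (Input i c)) ->
  [/\ onth P o = Some (IRead i (o + size (code o.+1 c)).+2),
      code_at P o.+1 (code o.+1 c)
    & onth P (o + size (code o.+1 c)).+1 = Some (IJmp o)].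
Proof. by move=> /= /code_at_loop. Qed.

Lemma code_exec P c s t : exec c s t -> forall o, code_at P o (code o c) ->
  exists n, nsteps (cstep P) n (o, s) (o + size (code o c), t).
Proof.
elim=> {c s t}.
- by move=> s o _; exists 0; rewrite addn0.
- move=> i r p q o /(_ 0 isT); rewrite addn0 /= => h.
  by exists 1, (o.+1, (upd r i (r i).+1, p, q)); rewrite /= ?h ?addn1.
- move=> i r p q o /(_ 0 isT); rewrite addn0 /= => h.
  exists 1, (o.+1, (upd r i (r i).-1, p, q)); rewrite /= ?h ?addn1 //.
  case: eqP => // e; congr (Some (_, (_, _, _))).
  by apply/funext => j; rewrite /upd e; case: eqP => // ->.
- move=> b r q o /(_ 0 isT); rewrite addn0 /= => h.
  by exists 1, (o.+1, (r, [::], rcons q b)); rewrite /= ?h ?addn1.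
- move=> c d s t u _ IH1 _ IH2 o /= /code_at_cat[/IH1[m h1] /IH2[n h2]].
  by exists (m + n); apply: nsteps_trans h1 _; rewrite size_cat addnA.
- move=> i c r p q ri o /code_at_while[h _ _].
  exists 1, ((o + size (code o.+1 c)).+2, (r, p, q)); rewrite /= ?h ?ri //=.
  by rewrite size_rcons !addnS.
- move=> i c r p q s t ri _ IH1 _ IH2 o hc.
  have [h /IH1[m h1] h2] := code_at_while hc.
  have [n h3] := IH2 _ hc.
  exists (1 + (m + (1 + n))).
  apply: (@nsteps_trans _ _ _ _ _ (o.+1, (upd r i (r i).-1, p, q))).
    by eexists; last reflexivity; rewrite /= h (negbTE ri).
  apply: nsteps_trans h1 _; apply: nsteps_trans h3.
  eexists; last reflexivity.
  by case: (s) => [[r1 p1] q1]; rewrite addSn /cstep h2.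
- move=> i c r q o /code_at_input[h _ _].
  exists 1, ((o + size (code o.+1 c)).+2, (r, [::], q)); rewrite /= ?h //=.
  by rewrite size_rcons !addnS.
- move=> i c r b p s t _ IH1 _ IH2 o hc.
  have [h /IH1[m h1] h2] := code_at_input hc.
  have [n h3] := IH2 _ hc.
  exists (1 + (m + (1 + n))).
  apply: (@nsteps_trans _ _ _ _ _ (o.+1, (upd r i (r i + b), p, [::]))).
    by eexists; last reflexivity; rewrite /= h.
  apply: nsteps_trans h1 _; apply: nsteps_trans h3.
  eexists; last reflexivity.
  by case: (s) => [[r1 p1] q1]; rewrite addSn /cstep h2.
Qed.

(** [exec] describes terminating executions only. An infinite loop is seen through its rounds, each
    of which costs at least one step. *)
Lemma while_diverges P o i c (s : nat -> store) :
  code_at P o (code o (While i c)) ->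
  (forall n, (s n).1.1 i != 0 /\
     exec c (upd (s n).1.1 i ((s n).1.1 i).-1, (s n).1.2, (s n).2) (s n.+1)) ->
  forall n, exists2 m, n <= m & nsteps (cstep P) m (o, s 0) (o, s n).
Proof.
move=> hc hs; have [h0 hb hj] := code_at_while hc.
elim=> [|n [m nm IH]]; first by exists 0.
have [ri hs1] := hs n; have [l hl] := code_exec hs1 hb.
exists (m + (1 + (l + 1))); first by lia.
apply: nsteps_trans IH _.
apply: nsteps_trans; last apply: nsteps_trans hl _.
  eexists; last reflexivity.
  by case: (s n) ri => [[r p] q] /= ri; rewrite /cstep h0 (negbTE ri).
eexists; last reflexivity.
by case: (s n.+1) => [[r1 p1] q1]; rewrite addSn /cstep hj.
Qed.

(** * Counter programs on a Turing machine *)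

Inductive phase := Home | GoLeft | GoRight | Halted.

Definition phase_code (h : phase) : 'I_4 :=
  inord match h with Home => 0 | GoLeft => 1 | GoRight => 2 | Halted => 3 end.

Definition phase_decode (i : 'I_4) : phase :=
  match val i with 0 => Home | 1 => GoLeft | 2 => GoRight | _ => Halted end.

Lemma phase_codeK : cancel phase_code phase_decode.
Proof. by case; rewrite /phase_decode /= inordK. Qed.

HB.instance Definition _ := Finite.copy phase (can_type phase_codeK).

(* The unread input starts at the home cell.  An auxiliary symbol lies to the *)
(* left of it and carries a set of counters and possibly an output bit; the   *)
(* value of a counter is the number of cells in whose set it is.              *)
Definition track (K : nat) : finType := ({set 'I_K.+1} * option bool)%type.

Definition symbol (K : nat) : Type := option (bool + track K).

Definition aux_cell (K : nat) (A : {set 'I_K.+1}) (b : option bool) :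
    symbol K := Some (inr (A, b)).

(* Addresses outside the program lead to the final phase, which turns the     *)
(* output bits into ordinary bits and stops on the first one.                 *)
Definition counter_trans (K : nat) (P : seq instr) (q : 'I_K.+1 * phase)
    (s : symbol K) : option (('I_K.+1 * phase) * symbol K * direction) :=
  let: (pc, h) := q in
  let next : 'I_K.+1 := inord pc.+1 in
  match h with
  | Home =>
      match onth P pc, s with
      | Some (IEmit b), _ =>
          Some ((next, Home), aux_cell finset.set0 (Some b), Right)
      | Some (IRead i a), Some (inl b) =>
          Some ((next, Home),
                aux_cell (if b then [set inord i] else finset.set0) None, Right)
      | Some (IRead i a), _ => Some ((inord a, Home), s, Stay)
      | Some (IJmp a), _ => Some ((inord a, Home), s, Stay)
      | _, _ => Some ((pc, GoLeft), s, Left)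
      end
  | GoLeft =>
      match onth P pc, s with
      | Some (IInc i), Some (inr (A, b)) =>
          if inord i \in A then Some (q, s, Left)
          else Some ((next, GoRight), aux_cell (inord i |: A) b, Right)
      | Some (IInc i), _ =>
          Some ((next, GoRight), aux_cell [set inord i] None, Right)
      | Some (IDec i a), Some (inr (A, b)) =>
          if inord i \in A
          then Some ((next, GoRight), aux_cell (A :\ inord i) b, Right)
          else Some (q, s, Left)
      | Some (IDec i a), _ =>
          Some ((inord a, GoRight), aux_cell finset.set0 None, Right)
      | None, Some (inr (_, Some b)) => Some (q, Some (inl b), Left)
      | _, _ => Some ((pc, Halted), s, Right)
      end
  | GoRight =>
      if s is Some (inr _) then Some (q, s, Right)
      else Some ((pc, Home), s, Stay)
  | Halted => None
  end.

Definition counter_tm (K : nat) (P : seq instr) : turing_machine :=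
  @TuringMachine ('I_K.+1 * phase)%type (track K) (ord0, Home)
    (@counter_trans K P).

(** * Counters as marks on the tape *)

Definition cells (K : nat) (vs : seq (track K)) : seq (symbol K) :=
  [seq Some (inr v) | v <- vs].

Definition marks (K : nat) (vs : seq (track K)) (a : 'I_K.+1) : nat :=
  count (fun v : track K => a \in v.1) vs.

Fixpoint add_mark (K : nat) (a : 'I_K.+1) (vs : seq (track K)) :=
  if vs is v :: vs' then
    if a \in v.1 then v :: add_mark a vs' else (a |: v.1, v.2) :: vs'
  else [:: ([set a], None) : track K].

(** Reaching the end of the list means that the counter is 0; the machine still turns the blank
    found there into an unmarked auxiliary cell. *)
Fixpoint remove_mark (K : nat) (a : 'I_K.+1) (vs : seq (track K)) :=
  if vs is v :: vs' then
    if a \in v.1 then (v.1 :\ a, v.2) :: vs' else v :: remove_mark a vs'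
  else [:: (finset.set0, None) : track K].

Lemma marks_cons K v vs (a : 'I_K.+1) :
  marks (v :: vs) a = (a \in v.1) + marks vs a.
Proof. by []. Qed.

Lemma marks_add K (a b : 'I_K.+1) vs :
  marks (add_mark a vs) b = marks vs b + (b == a).
Proof.
elim: vs => [|v vs IH]; first by rewrite marks_cons finset.in_set1 addn0.
rewrite [add_mark _ _]/=; case: ifP => h; rewrite !marks_cons ?IH ?addnA //.
by rewrite finset.in_setU1; case: eqP => [->|_] /=;
  rewrite ?h ?addn0 ?subn0 //; lia.
Qed.

Lemma marks_remove K (a b : 'I_K.+1) vs :
  marks (remove_mark a vs) b = marks vs b - (b == a).
Proof.
elim: vs => [|v vs IH]; first by rewrite marks_cons finset.in_set0.
rewrite [remove_mark _ _]/=; case: ifP => h; rewrite !marks_cons ?IH.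
  by rewrite finset.in_setD1; case: eqP => [->|_] /=;
    rewrite ?h ?addn0 ?subn0 //; lia.
by case: eqP => [->|_] /=; rewrite ?h ?addn0 ?subn0 //; lia.
Qed.

(** The list [vs] goes away from the home cell, so the bit emitted last comes first. *)
Definition tagged (K : nat) (vs : seq (track K)) (o : seq bool) :=
  exists n, [seq v.2 | v <- vs] = [seq Some b | b <- rev o] ++ nseq n None.

Lemma tagged_ext K (vs ws : seq (track K)) o :
  (exists n, [seq v.2 | v <- ws] = [seq v.2 | v <- vs] ++ nseq n None) ->
  tagged vs o -> tagged ws o.
Proof.
move=> [m e] [n h]; exists (n + m).
by rewrite e h -catA -nseqD.
Qed.

Lemma tagged_add K (a : 'I_K.+1) vs o : tagged vs o -> tagged (add_mark a vs) o.
Proof.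
apply: tagged_ext; elim: vs => [|v vs [n IH]] /=; first by exists 1.
by case: ifP => _ /=; [exists n; rewrite IH | exists 0; rewrite cats0].
Qed.

Lemma tagged_remove K (a : 'I_K.+1) vs o :
  tagged vs o -> tagged (remove_mark a vs) o.
Proof.
apply: tagged_ext; elim: vs => [|v vs [n IH]] /=; first by exists 1.
by case: ifP => _ /=; [exists 0; rewrite cats0 | exists n; rewrite IH].
Qed.

Section CounterMachine.
Context (K : nat) (P : seq instr).
Local Notation M := (counter_tm K P).
Local Notation stp := (@Defs.step M).

Definition home_config (pc : nat) (vs : seq (track K)) (w : seq bool) :
    config M :=
  let t : seq (cell M) := [seq Some (inl b) | b <- w] in
  @Config M (inord pc, Home) (cells vs) (head None t) (behead t).

Definition steps_to (k k' : config M) := exists n, nsteps stp n k k'.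

Lemma steps_to1 k k' k'' : stp k = Some k' -> steps_to k' k'' -> steps_to k k''.
Proof. by move=> h [n hn]; exists n.+1, k'. Qed.

Lemma go_right pc us l w :
  let t := [seq Some (inl b) | b <- w] in
  let r : seq (cell M) := cells us ++ head None t :: behead t in
  steps_to (@Config M (inord pc, GoRight) l (head None r) (behead r))
    (@Config M (inord pc, Home) (cells (rev us) ++ l) (head None t) (behead t)).
Proof.
elim: us l => [|u us IH] l /=.
  by exists 1; case: w => [|b w]; eexists.
apply: steps_to1; first by reflexivity.
rewrite rev_cons -cats1 /cells map_cat -catA; exact: IH.
Qed.

(** A leftward scan in progress: [vs] lies ahead, its first cell under the head, and [us] has been
    passed, the latest cell first. The whole track is [catrev us vs]. *)
Definition left_config (pc : nat) (vs us : seq (track K)) (w : seq bool) :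
    config M :=
  let t : seq (cell M) := [seq Some (inl b) | b <- w] in
  @Config M (inord pc, GoLeft) (behead (cells vs)) (head None (cells vs))
    (cells us ++ head None t :: behead t).

Lemma turn_right pc v vs us w :
  let t : seq (cell M) := [seq Some (inl b) | b <- w] in
  let r : seq (cell M) := cells us ++ head None t :: behead t in
  steps_to (@Config M (inord pc, GoRight) (Some (inr v) :: cells vs)
              (head None r) (behead r))
    (home_config pc (catrev us (v :: vs)) w).
Proof.
rewrite /home_config catrevE /cells map_cat; exact: go_right.
Qed.

Lemma go_inc pc i vs us w : pc <= K -> onth P pc = Some (IInc i) ->
  steps_to (left_config pc vs us w)
    (home_config pc.+1 (catrev us (add_mark (inord i) vs)) w).
Proof.
move=> hpc hP; elim: vs us => [|[A b] vs IH] us.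
  apply: steps_to1; last exact: turn_right.
  by rewrite /Defs.step /= inordK // hP.
case: (boolP (inord i \in A)) => hA.
  have -> : add_mark (inord i) ((A, b) :: vs) =
            (A, b) :: add_mark (inord i) vs by rewrite /= hA.
  apply: steps_to1 (IH ((A, b) :: us)).
  by rewrite /Defs.step /= inordK // hP hA.
rewrite /= (negbTE hA); apply: steps_to1; last exact: turn_right.
by rewrite /Defs.step /= inordK // hP (negbTE hA).
Qed.

Lemma go_dec pc i a vs us w : pc <= K -> onth P pc = Some (IDec i a) ->
  steps_to (left_config pc vs us w)
    (home_config (if marks vs (inord i) == 0 then a else pc.+1)
       (catrev us (remove_mark (inord i) vs)) w).
Proof.
move=> hpc hP; elim: vs us => [|[A b] vs IH] us.
  apply: steps_to1; last exact: turn_right.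
  by rewrite /Defs.step /= inordK // hP.
rewrite marks_cons addn_eq0; case: (boolP (inord i \in A)) => hA.
  rewrite /= hA; apply: steps_to1; last exact: turn_right.
  by rewrite /Defs.step /= inordK // hP hA.
have -> : remove_mark (inord i) ((A, b) :: vs) =
          (A, b) :: remove_mark (inord i) vs by rewrite /= (negbTE hA).
apply: steps_to1 (IH ((A, b) :: us)).
by rewrite /Defs.step /= inordK // hP (negbTE hA).
Qed.

(** Here [o] is the output still to be converted, last bit first, and [o'] the block already
    converted, which ends at the blank home cell. The induction moves bits from [o] to [o']. *)
Lemma go_halt pc (vs : seq (track K)) o o' n us : pc <= K ->
  onth P pc = None ->
  [seq v.2 | v <- vs] = [seq Some b | b <- o] ++ nseq n None ->
  exists k, steps_to (@Config M (inord pc, GoLeft) (behead (cells vs))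
      (head None (cells vs)) ([seq Some (inl b) | b <- o'] ++ None :: us)) k /\
    (stp k = None /\ output k = rev o ++ o').
Proof.
move=> hpc hP; elim: o vs o' => [|b o IH] vs o' h.
  set r := _ ++ _.
  exists (@Config M (inord pc, Halted)
            (head None (cells vs) :: behead (cells vs))
            (head None r) (behead r)).
  split; first (apply: steps_to1; last by exists 0; reflexivity).
    rewrite /Defs.step /= inordK // hP.
    by case: vs h => [|[A [b|]] vs] //= h; case: n h.
  split; first by [].
  rewrite /output /r /=; case: o' @r => //= b o'.
  by congr (_ :: _); elim: o' => //= b' o' ->.
case: vs h => [|[A b'] vs] //= [-> h].
have [k [h1 [h2 h3]]] := IH vs (b :: o') h.
exists k; split; last by split=> //; rewrite h3 rev_cons cat_rcons.
apply: steps_to1 h1.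
by rewrite /Defs.step /= inordK // hP.
Qed.

Definition represents (k : nat * store) (c : config M) :=
  let: (pc, (r, p, o)) := k in
  exists2 vs, c = home_config pc vs p &
    [/\ pc <= K, forall i, i <= K -> marks vs (inord i) = r i & tagged vs o].

(** Under this condition [inord] never distorts a counter index or an address. *)
Definition bounded :=
  forall pc, match onth P pc with
             | Some (IInc i) => pc < K /\ i <= K
             | Some (IDec i a) | Some (IRead i a) =>
                 [/\ pc < K, i <= K & a <= K]
             | Some (IEmit _) => pc < K
             | Some (IJmp a) => a <= K
             | None => True
             end.

Lemma inord_inj i j : i <= K -> j <= K ->
  ((inord i : 'I_K.+1) == inord j) = (i == j).
Proof. by move=> hi hj; rewrite -val_eqE /= !inordK. Qed.

Lemma tagged_cons (v : track K) vs o b : tagged vs o -> v.2 = Some b ->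
  tagged (v :: vs) (rcons o b).
Proof. by move=> [n h] hv; exists n; rewrite /= hv h rev_rcons. Qed.

(** Each instruction costs at least one machine step, whence [n.+1]; this is what transfers
    divergence to the Turing machine. *)
Lemma step_simulated k k' c : bounded -> cstep P k = Some k' ->
  represents k c ->
  exists n c', nsteps stp n.+1 c c' /\ represents k' c'.
Proof.
move=> /(_ k.1); case: k => [pc [[r p] o]] /= hb hk [vs -> [hpc hr ht]].
have hl ins : onth P pc = Some ins ->
    match ins with IInc _ | IDec _ _ => True | _ => False end ->
    stp (home_config pc vs p) = Some (left_config pc vs [::] p).
  by move=> e; rewrite /Defs.step /= inordK // e; case: ins e.
case e : (onth P pc) hb hk => [[i|i a|b|i a|a]|] //.
- move=> [h1 h2] [<-].
  have [n hn] := go_inc vs [::] p hpc e.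
  exists n; eexists; split; first by eexists; [exact: hl e I | exact: hn].
  eexists; first reflexivity.
  split=> //; last exact: tagged_add.
  move=> j hj; rewrite marks_add inord_inj // hr // /upd.
  by case: eqP => [->|_]; rewrite ?addn1 ?addn0.
- move=> [h1 h2 h3]; rewrite -hr // => hk.
  have [n hn] := go_dec vs [::] p hpc e.
  exists n; eexists; split; first by eexists; [exact: hl e I | exact: hn].
  rewrite -[catrev _ _]/(remove_mark (inord i) vs); case: eqP hk => h0 [<-];
    (eexists; first reflexivity); split=> //; try exact: tagged_remove.
    move=> j hj; rewrite marks_remove inord_inj // hr //.
    by case: eqP => [->|_]; rewrite ?subn0 // -hr // h0.
  move=> j hj; rewrite marks_remove inord_inj // !hr // /upd.
  by case: eqP => [->|_]; rewrite ?subn1 ?subn0.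
- case: p hl => [|//] _ h1 [<-].
  exists 0, (home_config pc.+1 ((finset.set0, Some b) :: vs) [::]); split.
    by eexists; last reflexivity; rewrite /Defs.step /= inordK // e.
  eexists; first reflexivity.
  split=> //; last exact: tagged_cons.
  by move=> j hj; rewrite marks_cons finset.in_set0 hr.
- move=> [h1 h2 h3].
  case: p hl => [|b p] _; last case: o ht => // ht; case=> <-.
    exists 0, (home_config a vs [::]); split; last by exists vs.
    by eexists; last reflexivity; rewrite /Defs.step /= inordK // e.
  set A := if b then [set inord i] else finset.set0 : {set 'I_K.+1}.
  exists 0, (home_config pc.+1 ((A, None) :: vs) p); split.
    by eexists; last reflexivity; rewrite /Defs.step /= inordK // e.
  eexists; first reflexivity.
  split=> //; last by case: ht => n /= h; exists n.+1; rewrite /= h.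
  move=> j hj; rewrite marks_cons hr // /A /upd; case: b {A}.
    rewrite finset.in_set1 inord_inj //.
    by case: eqP => [->|_] //; rewrite addnC.
  by rewrite finset.in_set0; case: eqP => [->|//]; rewrite addn0.
- move=> h1 [<-].
  exists 0, (home_config a vs p); split; last by exists vs.
  by eexists; last reflexivity; rewrite /Defs.step /= inordK // e.
Qed.

Lemma steps_simulated n k k' c : bounded -> nsteps (cstep P) n k k' ->
  represents k c ->
  exists m c', [/\ n <= m, nsteps stp m c c' & represents k' c'].
Proof.
move=> hb; elim: n k c => [|n IH] k c /=; first by move=> <- ?; exists 0, c.
case=> k1 /(step_simulated hb) h1 /IH h2.
move=> /h1[m [c1 [hm /h2[m' [c' [h3 h4 h5]]]]]].
exists (m.+1 + m'), c'; split => //; first by lia.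
exact: nsteps_trans hm h4.
Qed.

End CounterMachine.

Definition instr_bound (ins : instr) : nat :=
  match ins with
  | IInc i => i
  | IDec i a | IRead i a => maxn i a
  | IEmit _ => 0
  | IJmp a => a
  end.

Definition program_bound (P : seq instr) : nat :=
  size P + \sum_(ins <- P) instr_bound ins.

Lemma program_bounded P : bounded (program_bound P) P.
Proof.
move=> pc; case e : (onth P pc) => [ins|] //.
have h1 : pc < size P by rewrite -onthTE e.
have h2 : instr_bound ins <= \sum_(ins <- P) instr_bound ins.
  elim: P pc e {h1} => [|x P IH] [|pc] //= h; rewrite big_cons.
    by case: h => ->; rewrite leq_addr.
  exact: leq_trans (IH _ h) (leq_addl _ _).
have h3 : instr_bound ins <= program_bound P.
  exact: leq_trans h2 (leq_addl _ _).
have h4 : pc < program_bound P by rewrite ltn_addr.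
by case: ins {e h2} h3 => //= *; split=> //; lia.
Qed.

Lemma run_nsteps (M : turing_machine) n (k k' : config M) :
  nsteps (@Defs.step M) n k k' -> Defs.step k' = None -> run n k = Some k'.
Proof.
elim: n k => [|n IH] k /=; first by move=> -> ->.
by case=> k1 -> /IH.
Qed.

Lemma run_ge (M : turing_machine) n m (k k1 k' : config M) :
  nsteps (@Defs.step M) m k k' -> n < m -> run n k = Some k1 -> False.
Proof.
elim: m n k => // m IH n k [k2 h1 h2].
by case: n => [|n] /=; rewrite h1 // => /(IH _ _ h2).
Qed.

Definition command_tm (c : cmd) : turing_machine :=
  counter_tm (program_bound (code 0 c)) (code 0 c).

Definition start_store (x : seq bool) : store := (fun=> 0, x, [::]).

Lemma represents_init c x :
  represents (0, start_store x) (Defs.init (command_tm c) x).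
Proof.
exists [::]; last by split=> //; exists 0.
rewrite /home_config /Defs.init; congr (@Config (command_tm c) (_, _)).
by apply: val_inj; rewrite /= inordK.
Qed.

Lemma command_computes c x r y :
  exec c (start_store x) (r, [::], y) -> computes (command_tm c) x y.
Proof.
move=> h; have [|n hn] := @code_exec (code 0 c) _ _ _ h 0; first by move=> j.
have [m [k [_ h1 [vs e [h2 _ [l h3]]]]]] :=
  steps_simulated (@program_bounded _) hn (represents_init c x).
have [|k' [[n' h4] [h5 h6]]] :=
  @go_halt _ (code 0 c) _ _ _ [::] _ [::] h2 _ h3.
  exact: onth_default.
exists (m + (n'.+1)), k'; split; last by rewrite h6 revK cats0.
apply: run_nsteps h5; apply: nsteps_trans h1 _.
rewrite e; eexists; last exact: h4.
by rewrite /Defs.step /= inordK // onth_default.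
Qed.

Lemma command_diverges c x :
  (forall n, exists m k,
     n <= m /\ nsteps (cstep (code 0 c)) m (0, start_store x) k) ->
  ~ dom (command_tm c) x.
Proof.
move=> h [n [k hk]]; have [m [k1 [h1 h2]]] := h n.+1.
have [m' [c' [h3 h4 _]]] :=
  steps_simulated (@program_bounded _) h2 (represents_init c x).
exact: run_ge h4 (leq_trans h1 h3) hk.
Qed.

(** * Functions computable by counter programs *)

(* Arguments are read from the registers [v 0], [v 1], etc., all below [b],   *)
(* and the result is written to the register [b]; the registers after [b]     *)
(* serve as workspace and are cleared afterwards.                             *)
Definition computable (f : env -> nat) : Prop :=
  forall (v : nat -> nat) (b : nat), (forall i, v i < b) ->
  exists c, forall r p o, (forall j, b <= j -> r j = 0) ->
    exec c (r, p, o) (upd r b (f (fun i => r (v i))), p, o).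

Definition scons (x : nat) (r : env) : env :=
  fun i => if i is j.+1 then r j else x.

Lemma exec_eq c r r' p o s :
  r =1 r' -> exec c (r, p, o) s -> exec c (r', p, o) s.
Proof. by move=> /funext ->. Qed.

Lemma exec_eqr c r r' p o s :
  r =1 r' -> exec c s (r, p, o) -> exec c s (r', p, o).
Proof. by move=> /funext ->. Qed.

(** [g k] is the store after k rounds; the loops below are handled by giving such a [g]
    explicitly. *)
Lemma exec_loop i c n (g : nat -> store) :
  (forall k, k <= n -> (g k).1.1 i = n - k) ->
  (forall k, k < n ->
     exec c (upd (g k).1.1 i (n - k).-1, (g k).1.2, (g k).2) (g k.+1)) ->
  exec (While i c) (g 0) (g n).
Proof.
elim: n g => [|n IH] g h1 h2.
  by have := h1 0 isT; case: (g 0) => [[r p] o] /= h; apply: XWhile0.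
have := h1 0 isT; have := h2 0 isT.
have {IH} : exec (While i c) (g 1) (g n.+1).
  apply: (IH (fun k => g k.+1)) => k hk; first by rewrite h1 ?subSS.
  by have := h2 k.+1 hk; rewrite subSS.
case: (g 0) => [[r p] o] /= h3 h4 h5.
by apply: XWhileS h3; rewrite h5 // -h5.
Qed.

Ltac upd_cases :=
  rewrite /= /upd /=;
  repeat (case: eqP => ?; try (exfalso; lia); subst); try done; try lia.

Ltac upd_tac := move=> ?; upd_cases.

Lemma exec_clear i r p o : exec (While i Skip) (r, p, o) (upd r i 0, p, o).
Proof.
pose g k : store := (upd r i (r i - k), p, o).
have -> : (r, p, o) = g 0.
  by congr (_, _, _); apply/funext; upd_tac.
have -> : (upd r i 0, p, o) = g (r i) by rewrite /g subnn.
apply: exec_loop => k hk; first by rewrite /g /upd /= eqxx.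
apply: (@exec_eq _ (upd r i (r i - k.+1))); last exact: XSkip.
by upd_tac.
Qed.

Lemma exec_move i j r p o : i != j ->
  exec (While i (Inc j)) (r, p, o) (upd (upd r i 0) j (r j + r i), p, o).
Proof.
move=> /eqP ij; pose g k : store := (upd (upd r i (r i - k)) j (r j + k), p, o).
have -> : (r, p, o) = g 0.
  by congr (_, _, _); apply/funext; upd_tac.
have -> : (upd (upd r i 0) j (r j + r i), p, o) = g (r i).
  by rewrite /g subnn.
apply: exec_loop => k hk; first by rewrite /g /upd /= eqxx; case: eqP.
rewrite /=; apply: exec_eqr; last exact: XInc.
by upd_tac.
Qed.

Lemma exec_move2 i j k r p o : i != j -> i != k -> j != k ->
  exec (While i (Seq (Inc j) (Inc k))) (r, p, o)
    (upd (upd (upd r i 0) j (r j + r i)) k (r k + r i), p, o).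
Proof.
move=> /eqP ij /eqP ik /eqP jk.
pose g n : store :=
  (upd (upd (upd r i (r i - n)) j (r j + n)) k (r k + n), p, o).
have -> : (r, p, o) = g 0.
  by congr (_, _, _); apply/funext; upd_tac.
have -> : (upd (upd (upd r i 0) j (r j + r i)) k (r k + r i), p, o) = g (r i).
  by rewrite /g subnn.
apply: exec_loop => n hn; first by rewrite /g; upd_cases.
rewrite /=; apply: XSeq; first exact: XInc.
apply: exec_eqr; last exact: XInc.
by upd_tac.
Qed.

(** Moving a counter empties it, so it is moved to two places at once and restored from the
    second. *)
Lemma computable_var i : computable (fun r => r i).
Proof.
move=> v b hv; have hi := hv i.
exists (Seq (While (v i) (Seq (Inc b) (Inc b.+1))) (While b.+1 (Inc (v i)))).
move=> r p o hr; have h0 := hr b (leqnn _); have h1 := hr b.+1 (leqnSn _).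
apply: XSeq; first by apply: exec_move2; lia.
by apply: exec_eqr; last (by apply: exec_move; lia); upd_tac.
Qed.

Lemma computable_const n : computable (fun=> n).
Proof.
move=> v b hv; elim: n => [|n [c IH]].
  exists Skip => r p o hr; apply: exec_eqr; last exact: XSkip.
  by move=> j; rewrite /upd; case: eqP => // ->; rewrite hr.
exists (Seq c (Inc b)) => r p o hr; apply: XSeq; first exact: IH.
by apply: exec_eqr; last exact: XInc; upd_tac.
Qed.

Lemma computable_succ f : computable f -> computable (fun r => (f r).+1).
Proof.
move=> hf v b hv; have [c hc] := hf v b hv.
exists (Seq c (Inc b)) => r p o hr; apply: XSeq; first exact: hc.
by apply: exec_eqr; last exact: XInc; upd_tac.
Qed.

Lemma computable_pred f : computable f -> computable (fun r => (f r).-1).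
Proof.
move=> hf v b hv; have [c hc] := hf v b hv.
exists (Seq c (Dec b)) => r p o hr; apply: XSeq; first exact: hc.
by apply: exec_eqr; last exact: XDec; upd_tac.
Qed.

Lemma computable_rename s f :
  computable f -> computable (fun r => f (fun i => r (s i))).
Proof.
move=> hf v b hv; have [c hc] := hf (fun i => v (s i)) b (fun i => hv (s i)).
by exists c.
Qed.

(** The value of g stays in register [b] as the new variable 0, while f works from [b.+1] on. *)
Lemma computable_let f g : computable f -> computable g ->
  computable (fun r => f (scons (g r) r)).
Proof.
move=> hf hg v b hv; have [cg hcg] := hg v b hv.
have [|cf hcf] := hf (scons b v) b.+1.
  by case=> [|i] /=; [exact: ltnSn | have := hv i; lia].
exists (Seq cg (Seq cf (Seq (While b Skip) (While b.+1 (Inc b))))) => r p o hr.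
apply: XSeq; first exact: hcg.
apply: XSeq; first by apply: hcf => j hj; rewrite /upd gtn_eqF // hr // ltnW.
apply: XSeq; first exact: exec_clear.
have hS := hr b.+1 (leqnSn _).
set x := f _; set y := f _.
have -> : x = y.
  congr f; apply/funext => -[|i]; rewrite /upd ?eqxx //=.
  by rewrite ltn_eqF // hv.
by apply: exec_eqr; last (by apply: exec_move; lia); upd_tac.
Qed.

Lemma computable_iteri n f x :
  computable n -> computable x ->
  computable (fun r => f (r 0) (r 1) (fun i => r i.+2)) ->
  computable (fun r => iteri (n r) (fun k a => f k a r) (x r)).
Proof.
move=> hn hx hf v b hv; have [cn hcn] := hn v b hv.
have [|cx hcx] := hx v b.+1; first by move=> i; have := hv i; lia.
have [|cf hcf] := hf (scons b.+2 (scons b.+1 v)) b.+3.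
  by case=> [|[|i]] /=; [lia|lia|have := hv i; lia].
(* Register [b] holds the number of rounds left, [b.+1] the accumulator, [b.+2] the index of the
   round, and [b.+3] the new value of the accumulator. *)
exists (Seq cn (Seq cx (Seq
  (While b (Seq cf (Seq (While b.+1 Skip) (Seq (While b.+3 (Inc b.+1))
    (Inc b.+2)))))
  (Seq (While b.+2 Skip) (While b.+1 (Inc b)))))) => r p o hr.
apply: XSeq; first exact: hcn.
apply: XSeq; first by apply: hcx => j hj; rewrite /upd gtn_eqF // hr // ltnW.
set N := n _; set X := x _.
have -> : X = x (fun i => r (v i)).
  by congr x; apply/funext => i; rewrite /upd ltn_eqF // hv.
move: {X}(x _) => X.
pose F k a := f k a (fun i => r (v i)).
pose g k : store :=
  (upd (upd (upd r b (N - k)) b.+1 (iteri k F X)) b.+2 k, p, o).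
have h1 := hr b.+1 (leqnSn _).
have h2 : r b.+2 = 0 by apply: hr; lia.
have h3 : r b.+3 = 0 by apply: hr; lia.
apply: (@XSeq _ _ _ (g N)).
  have -> : (upd (upd r b N) b.+1 X, p, o) = g 0.
    by congr (_, _, _); apply/funext; upd_tac.
  apply: exec_loop => k hk; first by rewrite /g; upd_cases.
  apply: XSeq.
    by apply: hcf => j hj; rewrite /g; upd_cases; apply: hr; lia.
  set Y := f _ _ _.
  have -> : Y = iteri k.+1 F X.
    pose R := upd (g k).1.1 b (N - k).-1.
    have e1 : R b.+2 = k by rewrite /R /g; upd_cases.
    have e2 : R b.+1 = iteri k F X.
      by rewrite /R /g /upd /= gtn_eqF // ltn_eqF // eqxx.
    have e3 : (fun i => R (v i)) = (fun i => r (v i)).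
      apply/funext => i; have h4 := hv i.
      by rewrite /R /g /= /upd !ltn_eqF //; lia.
    by rewrite -[Y]/(f (R b.+2) (R b.+1) (fun i => R (v i))) e1 e2 e3.
  apply: XSeq; first exact: exec_clear.
  apply: XSeq; first by apply: exec_move; lia.
  by apply: exec_eqr; last exact: XInc; move: (iteri _ _ _) => Z; upd_tac.
apply: XSeq; first exact: exec_clear.
rewrite -[iteri _ _ _]/(iteri N F X).
by apply: exec_eqr; last (by apply: exec_move; lia); upd_tac.
Qed.

Lemma computable_ext f g : f =1 g -> computable f -> computable g.
Proof. by move=> /funext ->. Qed.

Lemma computable_app h f :
  computable (fun r => h (r 0)) -> computable f ->
  computable (fun r => h (f r)).
Proof. exact: computable_let. Qed.

Lemma computable_app2 h f g : computable (fun r => h (r 0) (r 1)) ->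
  computable f -> computable g -> computable (fun r => h (f r) (g r)).
Proof.
move=> hh hf hg.
have h1 := @computable_let _ (fun r => f (fun i => r i.+1)) hh
  (computable_rename S hf).
exact: (computable_let h1 hg).
Qed.

Lemma computable_app3 h f g k :
  computable (fun r => h (r 0) (r 1) (r 2)) ->
  computable f -> computable g -> computable k ->
  computable (fun r => h (f r) (g r) (k r)).
Proof.
move=> hh hf hg hk.
have h1 := computable_let hh (computable_rename (fun i => i.+2) hf).
have h2 := computable_let h1 (computable_rename S hg).
exact: (computable_let h2 hk).
Qed.

Lemma iteri_const T n (f : T -> T) x : iteri n (fun=> f) x = iter n f x.
Proof. by elim: n => //= n ->. Qed.

Lemma computable_iter n f x : computable n -> computable x ->
  computable (fun r => f (r 1) (fun i => r i.+2)) ->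
  computable (fun r => iter (n r) (fun a => f a r) (x r)).
Proof.
move=> hn hx hf.
apply: computable_ext (computable_iteri (f := fun=> f) hn hx hf) => r.
exact: iteri_const.
Qed.

(** * Arithmetic and pairing *)

Lemma computable_add f g :
  computable f -> computable g -> computable (fun r => f r + g r).
Proof.
move=> hf hg; apply: computable_app2 => //.
apply: (@computable_ext (fun r => iter (r 0) (fun a => a.+1) (r 1))).
  by move=> r; elim: (r 0) => //= n ->; rewrite addSn.
apply: (@computable_iter _ (fun a _ => a.+1)); try exact: computable_var.
exact/computable_succ/computable_var.
Qed.

Lemma computable_mul f g :
  computable f -> computable g -> computable (fun r => f r * g r).
Proof.
move=> hf hg; apply: computable_app2 => //.
apply: (@computable_ext (fun r => iter (r 0) (fun a => a + r 1) 0)).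
  by move=> r; elim: (r 0) => //= n ->; rewrite mulSn addnC.
apply: (@computable_iter _ (fun a r => a + r 1)).
- exact: computable_var.
- exact: computable_const.
- by apply: computable_add; apply: computable_var.
Qed.

Lemma computable_sub f g :
  computable f -> computable g -> computable (fun r => f r - g r).
Proof.
move=> hf hg; apply: computable_app2 => //.
apply: (@computable_ext (fun r => iter (r 1) (fun a => a.-1) (r 0))).
  by move=> r; elim: (r 1) => [|n] /=; rewrite ?subn0 // subnS => ->.
apply: (@computable_iter _ (fun a _ => a.-1)); try exact: computable_var.
exact/computable_pred/computable_var.
Qed.

Lemma computable_not f : computable (fun r => (f r : bool) : nat) ->
  computable (fun r => ~~ f r : nat).
Proof.
move=> hf; apply: (@computable_ext (fun r => 1 - f r)).
  by move=> r; case: (f r).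
by apply: computable_sub => //; apply: computable_const.
Qed.

Lemma computable_and f g : computable (fun r => (f r : bool) : nat) ->
  computable (fun r => (g r : bool) : nat) ->
  computable (fun r => f r && g r : nat).
Proof.
move=> hf hg; apply: (@computable_ext (fun r => f r * g r)).
  by move=> r; rewrite mulnb.
exact: computable_mul.
Qed.

Lemma computable_leq f g :
  computable f -> computable g -> computable (fun r => f r <= g r : nat).
Proof.
move=> hf hg; apply: (@computable_ext (fun r => 1 - (f r - g r))).
  by move=> r; case: leqP; lia.
by apply: computable_sub; [exact: computable_const | exact: computable_sub].
Qed.

Lemma computable_eqn f g :
  computable f -> computable g -> computable (fun r => f r == g r : nat).
Proof.
move=> hf hg; apply: (@computable_ext (fun r => (f r <= g r) && (g r <= f r))).
  by move=> r; rewrite -eqn_leq.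
by apply: computable_and; apply: computable_leq.
Qed.

Lemma computable_if c f g : computable (fun r => (c r : bool) : nat) ->
  computable f -> computable g ->
  computable (fun r => if c r then f r else g r).
Proof.
move=> hc hf hg.
apply: (@computable_ext (fun r => c r * f r + ~~ c r * g r)).
  by move=> r; case: (c r) => /=; rewrite mul1n mul0n ?addn0.
by apply: computable_add; apply: computable_mul => //; apply: computable_not.
Qed.

Lemma computable_sum n f : computable n ->
  computable (fun r => f (r 0) (fun i => r i.+1)) ->
  computable (fun r => \sum_(i < n r) f i r).
Proof.
move=> hn hf.
apply: (@computable_ext (fun r => iteri (n r) (fun k a => a + f k r) 0)).
  by move=> r; elim: (n r) => [|m IH] /=; rewrite ?big_ord0 // big_ord_recr IH.
apply: (@computable_iteri _ (fun k a r => a + f k r)) => //.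
  exact: computable_const.
apply: computable_add; first exact: computable_var.
(* The renaming skips variable 1, the accumulator. *)
exact: (computable_rename (fun i => if i is j.+1 then j.+2 else 0) hf).
Qed.

Ltac computable_tac :=
  repeat first
    [ exact: computable_var | exact: computable_const
    | apply: computable_not | apply: computable_and | apply: computable_leq
    | apply: computable_eqn | apply: computable_if
    | apply: computable_sum; cbv beta
    | apply: computable_add | apply: computable_mul
    | apply: computable_sub | apply: computable_succ | apply: computable_pred ].

Lemma sum_ltn n m : \sum_(k < n) (k < m) = minn n m.
Proof.
elim: n => [|n IH]; first by rewrite big_ord0 min0n.
by rewrite big_ord_recr IH /=; case: ltnP; lia.
Qed.

(** The quotient counts the positive multiples of d up to m; the test on d matches the convention
    that division by 0 gives 0. *)
Lemma divn_sum m d : m %/ d = \sum_(k < m) (~~ (d == 0) && (k.+1 * d <= m)).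
Proof.
case: d => [|d]; first by rewrite divn0 big1.
rewrite -[LHS](minn_idPr (leq_div m d.+1)) -sum_ltn.
by apply: eq_bigr => k _; rewrite leq_divRL.
Qed.

Lemma computable_div f g :
  computable f -> computable g -> computable (fun r => f r %/ g r).
Proof.
move=> hf hg; apply: computable_app2 => //.
apply: computable_ext (fun r => esym (divn_sum (r 0) (r 1))) _.
apply: (@computable_sum _ (fun k r => ~~ (r 1 == 0) && (k.+1 * r 1 <= r 0))).
  by computable_tac.
by computable_tac.
Qed.

Lemma computable_mod f g :
  computable f -> computable g -> computable (fun r => f r %% g r).
Proof.
move=> hf hg; apply: (@computable_ext (fun r => f r - f r %/ g r * g r)).
  by move=> r; rewrite {1}(divn_eq (f r) (g r)) addKn.
by computable_tac => //; apply: computable_div.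
Qed.

Lemma computable_exp f g :
  computable f -> computable g -> computable (fun r => f r ^ g r).
Proof.
move=> hf hg; apply: computable_app2 => //.
apply: (@computable_ext (fun r => iter (r 1) (fun a => r 0 * a) 1)).
  by move=> r; elim: (r 1) => //= n ->; rewrite expnS.
by apply: (@computable_iter _ (fun a r => r 0 * a)); computable_tac.
Qed.

Lemma computable_fact f : computable f -> computable (fun r => (f r)`!).
Proof.
move=> hf; apply: (@computable_app factorial) => //.
apply: (@computable_ext (fun r => iteri (r 0) (fun k a => k.+1 * a) 1)).
  by move=> r; elim: (r 0) => //= n ->; rewrite factS.
by apply: (@computable_iteri _ (fun k a _ => k.+1 * a)); computable_tac.
Qed.

(** Injective, because a <= a + b makes (a + b)^2 the largest square not exceeding the value. *)
Definition npair (a b : nat) : nat := (a + b) ^ 2 + a.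

(** Exhaustive search written as a sum: by injectivity at most one pair passes the test. *)
Definition nfst (p : nat) : nat :=
  \sum_(a < p.+1) \sum_(b < p.+1) (npair a b == p) * a.

Definition nsnd (p : nat) : nat :=
  \sum_(a < p.+1) \sum_(b < p.+1) (npair a b == p) * b.

Lemma npair_inj a b a' b' : npair a b = npair a' b' -> a = a' /\ b = b'.
Proof.
rewrite /npair => h.
have h1 : a + b = a' + b' by nia.
by move: h; rewrite h1 => /addnI e; split; lia.
Qed.

Lemma npair_ge a b : a <= npair a b /\ b <= npair a b.
Proof. by rewrite /npair; nia. Qed.

Lemma npair_sum a b (F : nat -> nat -> nat) : let p := npair a b in
  \sum_(x < p.+1) \sum_(y < p.+1) (npair x y == p) * F x y = F a b.
Proof.
move=> p; have [ha hb] := npair_ge a b.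
rewrite (bigD1 (inord a)) //= (bigD1 (inord b)) //= !inordK ?ltnS //.
rewrite eqxx mul1n !big1 ?addn0 // => [x /eqP hx|y /eqP hy].
  rewrite big1 // => y _; case: eqP => // /npair_inj[e _].
  by case: hx; rewrite -e inord_val.
case: eqP => // /npair_inj[_ e].
by case: hy; rewrite -e inord_val.
Qed.

Lemma nfst_pair a b : nfst (npair a b) = a.
Proof. exact: (npair_sum a b (fun x _ => x)). Qed.

Lemma nsnd_pair a b : nsnd (npair a b) = b.
Proof. exact: (npair_sum a b (fun _ y => y)). Qed.

Lemma computable_pair f g :
  computable f -> computable g -> computable (fun r => npair (f r) (g r)).
Proof.
move=> hf hg.
by apply: computable_add => //; apply: computable_exp; computable_tac.
Qed.

Lemma computable_fst f : computable f -> computable (fun r => nfst (f r)).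
Proof.
move=> hf; apply: (@computable_app nfst) => //.
apply: (@computable_sum _
  (fun a r => \sum_(b < (r 0).+1) (npair a b == r 0) * a)).
  by computable_tac.
apply: (@computable_sum _ (fun b r => (npair (r 0) b == r 1) * r 0)).
  by computable_tac.
by computable_tac; apply: computable_pair; computable_tac.
Qed.

Lemma computable_snd f : computable f -> computable (fun r => nsnd (f r)).
Proof.
move=> hf; apply: (@computable_app nsnd) => //.
apply: (@computable_sum _
  (fun a r => \sum_(b < (r 0).+1) (npair a b == r 0) * b)).
  by computable_tac.
apply: (@computable_sum _ (fun b r => (npair (r 0) b == r 1) * b)).
  by computable_tac.
by computable_tac; apply: computable_pair; computable_tac.
Qed.

(** * A universal function on numbers *)

(* A sequence of numbers is coded by nested pairs; since [npair 0 0 = 0], it  *)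
(* is implicitly continued by zeros.                                          *)
Definition ncode (s : seq nat) : nat := foldr npair 0 s.

Definition nget (i t : nat) : nat := nfst (iter i nsnd t).

Lemma nfst0 : nfst 0 = 0. Proof. exact: (nfst_pair 0 0). Qed.
Lemma nsnd0 : nsnd 0 = 0. Proof. exact: (nsnd_pair 0 0). Qed.

Lemma nfst_ncode s : nfst (ncode s) = head 0 s.
Proof. by case: s => [|x s]; [exact: nfst0 | exact: nfst_pair]. Qed.

Lemma nsnd_ncode s : nsnd (ncode s) = ncode (behead s).
Proof. by case: s => [|x s]; [exact: nsnd0 | exact: nsnd_pair]. Qed.

Lemma nget_ncode i s : nget i (ncode s) = nth 0 s i.
Proof.
rewrite /nget; elim: i s => [|i IH] s; first by rewrite nfst_ncode; case: s.
by rewrite iterSr nsnd_ncode IH nth_behead.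
Qed.

(* A configuration of the coded machine is [npair q (npair h (npair l r))],   *)
(* with [h] the symbol under the head.  In the transition table 0 stands for  *)
(* halting and [(npair q (npair s d)).+1] for a move.                         *)
Definition uentry (T k : nat) : nat := nget (nfst (nsnd k)) (nget (nfst k) T).

(** Halting configurations are fixed, so iterating beyond the halting time is harmless. Since 0
    codes the blank and is the pair of 0 and 0, the coded tape never runs out. *)
Definition ustep (T k : nat) : nat :=
  let l := nfst (nsnd (nsnd k)) in
  let r := nsnd (nsnd (nsnd k)) in
  let a := (uentry T k).-1 in
  let s := nfst (nsnd a) in
  if uentry T k == 0 then k else
  npair (nfst a)
    (if nsnd (nsnd a) == 0 then npair (nfst l) (npair (nsnd l) (npair s r))
     else if nsnd (nsnd a) == 1 then npair s (npair l r)
     else npair (nfst r) (npair (npair s l) (nsnd r))).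

(** The number of rounds is the integer part of the binary logarithm of m, so the leading 1 is left
    out. Bits are pushed from the least significant one on, as symbols 1 and 2. *)
Definition uword (m : nat) : nat :=
  iteri (\sum_(j < m) (2 ^ j.+1 <= m))
    (fun i w => npair ((m %/ 2 ^ i) %% 2).+1 w) 0.

Definition uinit (q m : nat) : nat :=
  npair q (npair (nfst (uword m)) (npair 0 (nsnd (uword m)))).

(* The first component of a machine code is padding.                          *)
Definition usim (e m t : nat) : nat :=
  iter t (ustep (nsnd (nsnd e))) (uinit (nfst (nsnd e)) m).

Definition uhalts (e m t : nat) : bool :=
  uentry (nsnd (nsnd e)) (usim e m t) == 0.

Definition uresult (e m t : nat) : nat :=
  npair (nfst (nsnd (usim e m t))) (nsnd (nsnd (nsnd (usim e m t)))).

(* An input n = 2^i (2m+1) of the universal machine, whose binary word is     *)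
(* bin m followed by 1 0^i, asks for the value of machine i on bin m.         *)
Definition uindex (n : nat) : nat := \sum_(j < n) (n %% 2 ^ j.+1 == 0).

Definition uarg (n : nat) : nat := n %/ 2 ^ (uindex n).+1.

(** This is t! times the sum of 1/j over the j < t accepted within t steps: every such j > 0 divides
    t!, and the term for j = 0 vanishes. *)
Definition uweight (e t : nat) : nat := \sum_(j < t) uhalts e j t * (t`! %/ j).

Definition uaccepts (n t : nat) : bool :=
  ~~ (uarg n == 0) && ((uarg n < t) &&
  (uhalts (uindex n) (uarg n) t && (uweight (uindex n) t <= uindex n * t`!))).

(** Symbols 1 and 2 are the bits. At any other symbol the list stops advancing, which ends the
    output. *)
Definition unext (w : nat) : nat :=
  if ~~ (nfst w == 0) && (nfst w <= 2) then nsnd w else w.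

Definition udigit (n t j : nat) : nat :=
  nfst (iter j unext (uresult (uindex n) (uarg n) t)).

Lemma computable_nget f g :
  computable f -> computable g -> computable (fun r => nget (f r) (g r)).
Proof.
move=> hf hg; apply: (@computable_app2 nget) => //; apply: computable_fst.
apply: (@computable_iter _ (fun a _ => nsnd a)); try exact: computable_var.
exact/computable_snd/computable_var.
Qed.

Ltac computable_tac ::=
  repeat first
    [ exact: computable_var | exact: computable_const | assumption
    | apply: computable_not | apply: computable_and | apply: computable_leq
    | apply: computable_eqn
    | apply: computable_nget | apply: computable_fst | apply: computable_snd
    | apply: computable_pair | apply: computable_exp | apply: computable_div
    | apply: computable_mod | apply: computable_fact
    | apply: computable_add | apply: computable_mul
    | apply: computable_sub | apply: computable_succ | apply: computable_pred
    | apply: computable_if ].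

Lemma computable_uentry f g :
  computable f -> computable g -> computable (fun r => uentry (f r) (g r)).
Proof.
by move=> hf hg; apply: (@computable_app2 uentry) => //; computable_tac.
Qed.

Lemma computable_ustep f g :
  computable f -> computable g -> computable (fun r => ustep (f r) (g r)).
Proof.
move=> hf hg; apply: (@computable_app2 ustep) => //.
have h := computable_uentry (computable_var 0) (computable_var 1).
by rewrite /ustep; computable_tac.
Qed.

Lemma computable_uword f : computable f -> computable (fun r => uword (f r)).
Proof.
move=> hf; apply: (@computable_app uword) => //.
apply: (@computable_iteri _ (fun i w r => npair ((r 0 %/ 2 ^ i) %% 2).+1 w)).
- by apply: (@computable_sum _ (fun j r => 2 ^ j.+1 <= r 0)); computable_tac.
- by computable_tac.
- by computable_tac.
Qed.

Lemma computable_usim f g h : computable f -> computable g -> computable h ->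
  computable (fun r => usim (f r) (g r) (h r)).
Proof.
move=> hf hg hh; apply: (@computable_app3 usim) => //.
apply: (@computable_iter _ (fun k r => ustep (nsnd (nsnd (r 0))) k)).
- by computable_tac.
- have h1 := computable_uword (computable_var 1).
  by rewrite /uinit; computable_tac.
- by apply: computable_ustep; computable_tac.
Qed.

Lemma computable_uhalts f g h : computable f -> computable g -> computable h ->
  computable (fun r => uhalts (f r) (g r) (h r) : nat).
Proof.
move=> hf hg hh; apply: computable_eqn; last exact: computable_const.
by apply: computable_uentry; [computable_tac | exact: computable_usim].
Qed.

Lemma computable_uindex f : computable f -> computable (fun r => uindex (f r)).
Proof.
move=> hf; apply: (@computable_app uindex) => //.
by apply: (@computable_sum _ (fun j r => r 0 %% 2 ^ j.+1 == 0)); computable_tac.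
Qed.

Lemma computable_uarg f : computable f -> computable (fun r => uarg (f r)).
Proof.
move=> hf; have h := computable_uindex hf.
by rewrite /uarg; computable_tac.
Qed.

Lemma computable_uweight f g :
  computable f -> computable g -> computable (fun r => uweight (f r) (g r)).
Proof.
move=> hf hg; apply: (@computable_app2 uweight) => //.
apply: (@computable_sum _ (fun j r => uhalts (r 0) j (r 1) * ((r 1)`! %/ j))).
  exact: computable_var.
by apply: computable_mul; last computable_tac; apply: computable_uhalts;
  computable_tac.
Qed.

Lemma computable_uaccepts f g :
  computable f -> computable g ->
  computable (fun r => uaccepts (f r) (g r) : nat).
Proof.
move=> hf hg; have h1 := computable_uindex hf; have h2 := computable_uarg hf.
have h3 := computable_uweight h1 hg; have h4 := computable_uhalts h1 h2 hg.
by rewrite /uaccepts; computable_tac.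
Qed.

Lemma computable_uresult f g :
  computable f -> computable g ->
  computable (fun r => uresult (uindex (f r)) (uarg (f r)) (g r)).
Proof.
move=> hf hg.
have h := computable_usim (computable_uindex hf) (computable_uarg hf) hg.
by rewrite /uresult; computable_tac.
Qed.

Lemma computable_udigit f g h : computable f -> computable g -> computable h ->
  computable (fun r => udigit (f r) (g r) (h r)).
Proof.
move=> hf hg hh; apply: (@computable_app3 udigit) => //.
apply: computable_fst; apply: (@computable_iter _ (fun w _ => unext w)).
- exact: computable_var.
- by apply: computable_uresult; apply: computable_var.
- by rewrite /unext; computable_tac.
Qed.

(** * Numbering Turing machines *)

(** [uindex] counts the positive powers of 2 dividing n, hence is the 2-adic valuation; its range
    suffices because i <= n. *)
Lemma uindexE i m : uindex (2 ^ i * m.*2.+1) = i.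
Proof.
rewrite /uindex; set n := 2 ^ i * _.
have hi : i <= n by rewrite /n; have := ltn_expl i (isT : 1 < 2); nia.
rewrite (_ : \sum_(j < n) _ = \sum_(j < n) (j < i)).
  by rewrite sum_ltn; apply/minn_idPr.
apply: eq_bigr => j _; congr nat_of_bool.
rewrite -/(2 ^ j.+1 %| n) /n pfactor_dvdn ?muln_gt0 ?expn_gt0 //.
rewrite lognM ?expn_gt0 // pfactorK // [logn _ m.*2.+1](_ : _ = 0) ?addn0 //.
by rewrite lognE /= dvdn2 /= odd_double.
Qed.

Lemma uargE i m : uarg (2 ^ i * m.*2.+1) = m.
Proof.
rewrite /uarg uindexE expnSr divnMl ?expn_gt0 //.
by rewrite -[m.*2.+1]addn1 divn2 addn1 /= uphalf_double.
Qed.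

Lemma uword_log m : \sum_(j < m) (2 ^ j.+1 <= m) = trunc_log 2 m.
Proof.
case: m => [|m]; first by rewrite big_ord0 trunc_log0.
have hL : trunc_log 2 m.+1 <= m.+1.
  apply: leq_trans (trunc_logP (isT : 1 < 2) (ltn0Sn m)).
  by rewrite ltnW // ltn_expl.
rewrite -[RHS](minn_idPr hL) -sum_ltn; apply: eq_bigr => j _.
congr nat_of_bool; apply/idP/idP => h; first exact: trunc_log_max.
apply: leq_trans (trunc_logP (isT : 1 < 2) (ltn0Sn m)).
by rewrite leq_exp2l.
Qed.

Lemma uwordE m : uword m = ncode [seq (b : bool).+1 | b <- bin m].
Proof.
rewrite /uword uword_log /bin; elim: (trunc_log 2 m) => // n IH.
by rewrite -addn1 iotaD rev_cat /= addn1 /= IH add0n modn2.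
Qed.

Definition digit_bits (d : nat) : seq bool :=
  if d == 1 then [:: false] else if d == 2 then [:: true] else [::].

Definition digits_bits (w n : nat) : seq bool :=
  flatten [seq digit_bits (nfst (iter j unext w)) | j <- iota 0 n].

Lemma digits_bitsS w n : digits_bits w n.+1 =
  digit_bits (nfst w) ++ digits_bits (unext w) n.
Proof.
rewrite /digits_bits /=; congr (_ ++ flatten _).
rewrite -[1]/(1 + 0) iotaDl -map_comp; apply: eq_map => j /=.
by rewrite -iterS iterSr.
Qed.

Section Coding.
Context (M : turing_machine).

Definition cell_code (c : cell M) : nat :=
  match c with
  | None => 0
  | Some (inl b) => (b : bool).+1
  | Some (inr a) => (enum_rank a).+3
  end.

Definition direction_code (d : direction) : nat :=
  match d with Left => 0 | Stay => 1 | Right => 2 end.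

Definition state_code (q : state M) : nat := enum_rank q.

Definition entry_code (q : state M) (c : cell M) : nat :=
  if trans q c is Some (q', s, d)
  then (npair (state_code q') (npair (cell_code s) (direction_code d))).+1
  else 0.

Definition all_cells : seq (cell M) :=
  [:: None, Some (inl false), Some (inl true)
    & [seq Some (inr a) | a <- enum (aux M)]].

Definition table_code : nat :=
  ncode [seq ncode [seq entry_code q c | c <- all_cells] | q <- enum (state M)].

Definition config_code (k : config M) : nat :=
  npair (state_code (cstate k)) (npair (cell_code (hcell k))
    (npair (ncode (map cell_code (lcells k)))
      (ncode (map cell_code (rcells k))))).

Lemma nget_table q c :
  nget (cell_code c) (nget (state_code q) table_code) = entry_code q c.
Proof.
rewrite /table_code nget_ncode (nth_map q); last first.
  by rewrite -cardE /state_code.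
rewrite nth_enum_rank nget_ncode (nth_map None).
  congr entry_code; case: c => [[[]|a]|] //=.
  by rewrite (nth_map a) ?nth_enum_rank // -cardE.
case: c => [[[]|a]|] //=; rewrite size_map -cardE.
by rewrite !ltnS.
Qed.

Lemma ncode_head (s : seq (cell M)) :
  nfst (ncode (map cell_code s)) = cell_code (head None s).
Proof. by rewrite nfst_ncode; case: s. Qed.

Lemma ncode_behead (s : seq (cell M)) :
  nsnd (ncode (map cell_code s)) = ncode (map cell_code (behead s)).
Proof. by rewrite nsnd_ncode; case: s. Qed.

Lemma uentry_config k :
  uentry table_code (config_code k) = entry_code (cstate k) (hcell k).
Proof.
by rewrite /uentry /config_code nfst_pair nsnd_pair nfst_pair nget_table.
Qed.

Lemma ustep_config k : ustep table_code (config_code k) =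
  if Defs.step k is Some k' then config_code k' else config_code k.
Proof.
rewrite /ustep uentry_config /entry_code /Defs.step.
case: (trans _ _) => [[[q s] d]|] //=.
rewrite [in nsnd (nsnd (nsnd _))]/config_code.
rewrite [in nfst (nsnd (nsnd (config_code _)))]/config_code.
by case: d; rewrite /config_code !(nfst_pair, nsnd_pair) //=
  -?ncode_head -?ncode_behead.
Qed.

Lemma uentry_halts k :
  (uentry table_code (config_code k) == 0) = ~~ isSome (Defs.step k).
Proof.
rewrite uentry_config /entry_code /Defs.step.
by case: (trans _ _) => [[[q s] d]|].
Qed.

Lemma run_coded t k : let n := iter t (ustep table_code) (config_code k) in
  if run t k is Some k' then (uentry table_code n == 0) /\ n = config_code k'
  else uentry table_code n != 0.
Proof.
elim: t k => [|t IH] k /=.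
  case e: (Defs.step k) => [k'|]; first by rewrite uentry_halts e.
  by rewrite uentry_halts e.
case e: (Defs.step k) => [k'|].
  by have := IH k'; rewrite -iterS iterSr ustep_config e.
rewrite (_ : iter t _ _ = config_code k); first by
  rewrite ustep_config e uentry_halts e.
by elim: t {IH} => //= t ->; rewrite ustep_config e.
Qed.

Lemma uinit_config m :
  uinit (state_code (start M)) m = config_code (Defs.init M (bin m)).
Proof.
rewrite /uinit /Defs.init /config_code /= uwordE.
have -> : [seq (b : bool).+1 | b <- bin m] =
    map cell_code [seq Some (inl b) | b <- bin m].
  by rewrite -[RHS]map_comp.
by rewrite ncode_head ncode_behead.
Qed.

Definition machine_code (pad : nat) : nat :=
  npair pad (npair (state_code (start M)) table_code).

Lemma uhalts_machine pad m t :
  uhalts (machine_code pad) m t = isSome (run t (Defs.init M (bin m))).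
Proof.
rewrite /uhalts /usim /machine_code !(nsnd_pair, nfst_pair).
rewrite uinit_config.
have := run_coded t (Defs.init M (bin m)).
by case: run => [k [-> _]|/negbTE ->].
Qed.

Lemma uresult_machine pad m t k : run t (Defs.init M (bin m)) = Some k ->
  uresult (machine_code pad) m t = ncode (map cell_code (hcell k :: rcells k)).
Proof.
move=> h; rewrite /uresult /usim /machine_code !(nsnd_pair, nfst_pair).
rewrite uinit_config.
have := run_coded t (Defs.init M (bin m)); rewrite h /= => -[_ ->].
by rewrite /config_code !(nsnd_pair, nfst_pair).
Qed.

Lemma digits_bits_leading (s : seq (cell M)) n :
  digits_bits (ncode (map cell_code s)) n = take n (leading_bits s).
Proof.
elim: n s => [|n IH] s; first by rewrite take0.
have hN (t : seq (cell M)) : leading_bits t = [::] -> 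
  digit_bits (nfst (ncode (map cell_code t))) = [::] /\
  unext (ncode (map cell_code t)) = ncode (map cell_code t).
  rewrite /unext ncode_head; case: t => [|[[b|a]|] t] //= _.
rewrite digits_bitsS.
case e : (leading_bits s) => [|b l].
  by have [-> ->] := hN _ e; rewrite IH e.
case: s e => [|[[c|a]|] s] //= [-> <-].
rewrite /unext nfst_pair nsnd_pair -IH.
by case: b.
Qed.

(** Because of this bound, a coded word w is read completely in w rounds. *)
Lemma leading_bits_size (s : seq (cell M)) :
  size (leading_bits s) <= ncode (map cell_code s).
Proof.
elim: s => [|[[b|a]|] s IH] //=; rewrite /npair.
by apply: leq_ltn_trans IH _; nia.
Qed.

Lemma digits_bits_output pad m t k (w := uresult (machine_code pad) m t) :
  run t (Defs.init M (bin m)) = Some k -> digits_bits w w = output k.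
Proof.
move=> /(@uresult_machine pad) e; rewrite /w e digits_bits_leading.
exact/take_oversize/leading_bits_size.
Qed.

End Coding.

(** * The universal machine *)

Definition registers (n t f : nat) : env :=
  upd (upd (upd (fun=> 0) 0 n) 1 t) 2 f.

(** Horner's rule: register 0 starts at 1, the leading digit that [bin] drops. Each round doubles it
    through registers 2 and 3 and adds the bit in register 1. *)
Definition read_number : cmd :=
  Seq (Inc 0) (Input 1 (Seq (While 0 (Seq (Inc 2) (Inc 3)))
    (Seq (While 3 (Inc 2)) (Seq (While 1 (Inc 2)) (While 2 (Inc 0)))))).

Lemma exec_input_number x n :
  exec (Input 1 (Seq (While 0 (Seq (Inc 2) (Inc 3)))
      (Seq (While 3 (Inc 2)) (Seq (While 1 (Inc 2)) (While 2 (Inc 0))))))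
    (registers n 0 0, x, [::])
    (registers (foldl (fun n (b : bool) => n.*2 + b) n x) 0 0, [::], [::]).
Proof.
elim: x n => [|b x IH] n; first exact: XInput0.
apply: XInputS (IH _).
apply: XSeq; first exact: exec_move2.
apply: XSeq; first exact: exec_move.
apply: XSeq; first exact: exec_move.
apply: exec_eqr; last exact: exec_move.
by case=> [|[|[|[|j]]]] //=; rewrite /registers /upd /=; lia.
Qed.

Lemma exec_read_number x :
  exec read_number (start_store x) (registers (num x) 0 0, [::], [::]).
Proof.
apply: XSeq; first exact: XInc.
apply: exec_eq (exec_input_number x 1).
by case=> [|[|[|j]]].
Qed.

Lemma exec_emit i b r o : exec (While i (Emit b)) (r, [::], o)
  (upd r i 0, [::], o ++ nseq (r i) b).
Proof.
pose g k : store := (upd r i (r i - k), [::], o ++ nseq k b).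
have -> : (r, [::], o) = g 0.
  by rewrite /g cats0; congr (_, _, _); apply/funext; upd_tac.
rewrite (_ : (upd r i 0, _, _) = g (r i)); last by rewrite /g subnn.
apply: exec_loop => k hk; first by rewrite /g /upd /= eqxx.
apply: (@exec_eq _ (upd r i (r i - k.+1))); first by upd_tac.
have -> : g k.+1 = (upd r i (r i - k.+1), [::], rcons (o ++ nseq k b) b).
  by rewrite /g -cats1 -catA -[[:: b]]/(nseq 1 b) -nseqD addn1.
exact: XEmit.
Qed.

Lemma digits_bits_rcons w n : digits_bits w n.+1 =
  digits_bits w n ++ digit_bits (nfst (iter n unext w)).
Proof.
by rewrite /digits_bits -addn1 iotaD map_cat flatten_cat /= cats0.
Qed.

(* The registers 0 and 1 hold the input number n and the stage t.             *)
Lemma computable_at (f : nat -> nat -> nat -> nat) i b : i < b -> 1 < b ->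
  computable (fun r => f (r 0) (r 1) (r 2)) ->
  exists c, forall r p o, (forall j, b <= j -> r j = 0) ->
    exec c (r, p, o) (upd r b (f (r 0) (r 1) (r i)), p, o).
Proof.
move=> hi hb hf.
have [|c hc] := hf
  (fun j => if j is j'.+1 then if j' is _.+1 then i else 1 else 0) b.
  by case=> [|[|j]] //; lia.
by exists c.
Qed.

(** Register 2 is the flag of the search loop, 1 as long as the current stage does not accept. *)
Lemma search_body : exists c, forall n t,
  exec c (registers n t 0, [::], [::])
    (registers n t.+1 (~~ uaccepts n t.+1), [::], [::]).
Proof.
have [|||c hc] := @computable_at (fun n t _ => ~~ uaccepts n t) 0 3 => //.
  by apply/computable_not/computable_uaccepts; exact: computable_var.
exists (Seq (Inc 1) (Seq c (While 3 (Inc 2)))) => n t.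
apply: XSeq; first exact: XInc.
apply: XSeq; first by apply: hc => -[|[|[|j]]].
apply: exec_eqr; last exact: exec_move.
by case=> [|[|[|[|j]]]].
Qed.

Lemma emit_result : exists c, forall n t,
  let w := uresult (uindex n) (uarg n) t in
  exists r, exec c (registers n t 0, [::], [::]) (r, [::], digits_bits w w).
Proof.
have [|||c0 h0] :=
  @computable_at (fun n t _ => uresult (uindex n) (uarg n) t) 0 2 => //.
  by apply: computable_uresult; exact: computable_var.
have hd k : exists c, forall r p o, (forall j, 4 <= j -> r j = 0) ->
    exec c (r, p, o) (upd r 4 (udigit (r 0) (r 1) (r 3) == k), p, o).
  apply: (@computable_at (fun n t j => udigit n t j == k)) => //.
  apply: computable_eqn; last exact: computable_const.
  by apply: computable_udigit; exact: computable_var.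
have [c1 h1] := hd 1; have [c2 h2] := hd 2.
(* Register 2 counts the remaining rounds and register 3 the digits done; register 4 is 0 or 1, so
   its loops emit at most one bit. *)
exists (Seq c0 (While 2 (Seq c1 (Seq (While 4 (Emit false))
  (Seq c2 (Seq (While 4 (Emit true)) (Inc 3))))))) => n t w.
pose g k : store := (upd (registers n t (w - k)) 3 k, [::], digits_bits w k).
exists (g w).1.1.
apply: XSeq; first by apply: h0 => -[|[|[|j]]].
rewrite (_ : (upd _ _ _, _, _) = g 0); last first.
  by congr (_, _, _); apply/funext => -[|[|[|[|j]]]] //=; rewrite subn0.
apply: (@exec_loop _ _ w g) => // k hk.
apply: XSeq; first by apply: h1 => -[|[|[|[|j]]]].
apply: XSeq; first exact: exec_emit.
apply: XSeq; first by apply: h2 => -[|[|[|[|[|j]]]]].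
apply: XSeq; first exact: exec_emit.
rewrite (_ : g k.+1 = (upd (registers n t (w - k.+1)) 3 k.+1, [::],
  (digits_bits w k ++ nseq (udigit n t k == 1) false)
     ++ nseq (udigit n t k == 2) true)).
  apply: exec_eqr; last exact: XInc.
  by case=> [|[|[|[|[|j]]]]] //=; rewrite /upd /= subnS.
congr (_, _, _); rewrite digits_bits_rcons -catA; congr (_ ++ _).
rewrite /digit_bits /udigit -/w; move: (nfst _) => d.
by case: d => [|[|[|d]]].
Qed.

Lemma universal_program : exists c : cmd, forall x (n := num x),
  (forall t, uaccepts n t -> exists2 t', uaccepts n t' &
     let w := uresult (uindex n) (uarg n) t' in
     computes (command_tm c) x (digits_bits w w)) /\
  (dom (command_tm c) x -> exists t, uaccepts n t).
Proof.
have [cs hs] := search_body; have [ce he] := emit_result.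
exists (Seq read_number (Seq (Inc 2) (Seq (While 2 cs) ce))) => x n.
have hi : exec (Inc 2) (registers n 0 0, [::], [::])
    (registers n 0 1, [::], [::]).
  apply: exec_eqr; last exact: XInc.
  by case=> [|[|[|j]]].
have hc t b : exec cs (upd (registers n t b) 2 0, [::], [::])
    (registers n t.+1 (~~ uaccepts n t.+1), [::], [::]).
  by apply: exec_eq (hs n t) => -[|[|[|j]]].
(* The search tests stages from 1 on, and nothing is missed. *)
have ha0 : uaccepts n 0 = false by rewrite /uaccepts ltn0 andbF.
split=> [t ht|hd].
  have hex : exists t, uaccepts n t by exists t.
  case: (ex_minnP hex) => t' ht' hmin; exists t' => // w.
  have [r hr] := he n t'.
  apply: command_computes; apply: XSeq (exec_read_number x) _.
  apply: XSeq hi _; apply: XSeq hr.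
  have hw d t0 : t0 + d.+1 = t' ->
      exec (While 2 cs) (registers n t0 1, [::], [::])
        (registers n t' 0, [::], [::]).
    elim: d t0 => [|d IH] t0 e.
      apply: (@XWhileS _ _ (registers n t0 1) _ _ _ _ _ (hc t0 1)) => //.
      by rewrite -[t0.+1]addn1 e ht'; exact: XWhile0.
    apply: (@XWhileS _ _ (registers n t0 1) _ _ _ _ _ (hc t0 1)) => //.
    have -> : uaccepts n t0.+1 = false.
      by apply/negP => /hmin; rewrite -e; lia.
    by apply: IH; rewrite -e; lia.
  case: t' ht' {hmin w} hw => [|d] ht' hw; first by rewrite ha0 in ht'.
  exact: (hw d 0 erefl).
case: (pselect (exists t, uaccepts n t)) => // hn.
have ha t : uaccepts n t = false by apply/negP => h; apply: hn; exists t.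
case: (@command_diverges _ _ _ hd) => m.
set P := code 0 _.
have hP : code_at P 0 P by [].
have [h1 /code_at_cat[h2 /code_at_cat[h3 _]]] := code_at_cat hP.
have [l1 hl1] := code_exec (exec_read_number x) h1.
have [l2 hl2] := code_exec hi h2.
pose s t : store := (registers n t 1, [::], [::]).
have [|l3 hm hl3] := @while_diverges _ _ _ _ s h3 _ m.
  by move=> t; split=> //; have := hc t 1; rewrite ha.
exists (l1 + (l2 + l3)); eexists; split; first by lia.
apply: nsteps_trans hl1 _; apply: nsteps_trans hl2 _; exact: hl3.
Qed.

(** * Bounding zeta *)

Lemma uhalts_mono e m t t' : t <= t' -> uhalts e m t -> uhalts e m t'.
Proof.
move=> /subnK <-; elim: (t' - t) => //= d IH /IH.
rewrite /uhalts addSn /usim iterS; set k := iter _ _ _ => /eqP h.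
by rewrite /ustep h eqxx h.
Qed.

Lemma uacceptsE i m t : uaccepts (2 ^ i * m.*2.+1) t =
  [&& 0 < m, m < t, uhalts i m t & uweight i t <= i * t`!].
Proof. by rewrite /uaccepts uindexE uargE lt0n. Qed.

(** The weight condition may be lost as the stage grows, but it holds at each accepting stage.
    Choosing an accepting stage for each accepted m < N, the largest one works, since halting
    persists. *)
Lemma uaccepts_stage i N : exists2 t, uweight i t <= i * t`! &
  forall m s, m < N -> uaccepts (2 ^ i * m.*2.+1) s ->
    [&& 0 < m, m < t & uhalts i m t].
Proof.
elim: N => [|N [t h1 h2]]; first by exists 0 => //; rewrite /uweight big_ord0.
have [[s]|hN] := pselect (exists s, uaccepts (2 ^ i * N.*2.+1) s); last first.
  exists t => // m s; rewrite ltnS leq_eqVlt => /orP[/eqP ->|hm] hs.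
    by case: hN; exists s.
  exact: h2 hm hs.
rewrite uacceptsE => /and4P[hN hNs hs hw].
exists (maxn t s); first by case: (leqP t s) => _.
move=> m u; rewrite ltnS leq_eqVlt => /orP[/eqP ->|hm] hu.
  rewrite hN (leq_trans hNs (leq_maxr _ _)) /=.
  exact: uhalts_mono (leq_maxr _ _) hs.
have /and3P[-> h3 h4] := h2 m u hm hu.
rewrite (leq_trans h3 (leq_maxl _ _)) /=.
exact: uhalts_mono (leq_maxl _ _) h4.
Qed.

Lemma odd_part n : 0 < n -> exists i m, n = 2 ^ i * m.*2.+1.
Proof.
elim/ltn_ind: n => n IH n0.
case: (boolP (odd n)) => hn.
  by exists 0, n./2; rewrite mul1n -[LHS]odd_double_half hn.
have e : n = 2 * n./2 by rewrite -[LHS]odd_double_half (negbTE hn) mul2n.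
have [||i [m h]] := IH n./2; [lia|lia|].
by exists i.+1, m; rewrite expnS -mulnA -h.
Qed.

Lemma size_bin_mul i k : 0 < k -> size (bin (2 ^ i * k)) = i + size (bin k).
Proof.
move=> k0; elim: i => [|i IH]; first by rewrite mul1n.
rewrite expnS -mulnA mul2n -[_.*2]addn0 (bin_double_add false).
  by rewrite size_rcons IH.
by rewrite muln_gt0 expn_gt0.
Qed.

(** * Real sums over the accepted inputs *)

Local Open Scope ring_scope.

Lemma ler_sum_ord (R : realType) (f : nat -> R) (P Q : pred nat) (m n : nat) :
  (forall k, 0 <= f k) ->
  (forall k, (k < m)%N -> P k -> (k < n)%N && Q k) ->
  \sum_(k < m | P k) f k <= \sum_(k < n | Q k) f k.
Proof.
move=> f0 h.
rewrite (big_ord_widen_cond (maxn m n) P f (leq_maxl m n)).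
rewrite (big_ord_widen_cond (maxn m n) Q f (leq_maxr m n)).
rewrite big_mkcond [leRHS]big_mkcond; apply: ler_sum => k _.
case: (boolP (P k && (k < m)%N)) => [/andP[hP hk]|_]; last by case: ifP.
by have := h k hk hP; rewrite andbC => ->.
Qed.

(** If k = 2^i (2m+1) < N then i and m are below N, so each term on the left occurs on the right. *)
Lemma sum_odd_part (R : realType) (f : nat -> R) N : (forall k, 0 <= f k) ->
  \sum_(k < N | (0 < k)%N) f k <=
  \sum_(i < N) \sum_(m < N) f (2 ^ i * m.*2.+1)%N.
Proof.
move=> f0.
apply: (@le_trans _ _ (\sum_(k < N | (0 < k)%N) \sum_(i < N) \sum_(m < N)
    if (2 ^ i * m.*2.+1 == k)%N then f k else 0)).
  apply: ler_sum => k k0; have [i [m e]] := odd_part k0.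
  have h1 : (i < N)%N.
    apply: leq_ltn_trans (ltn_ord k); rewrite e.
    by have := ltn_expl i (isT : 1 < 2)%N; nia.
  have h2 : (m < N)%N.
    apply: leq_ltn_trans (ltn_ord k); rewrite e.
    by have := expn_gt0 2 i; nia.
  have h0 i' m' : 0 <= if (2 ^ i' * m'.*2.+1 == k)%N then f k else 0.
    by case: ifP.
  rewrite (bigD1 (Ordinal h1)) //= (bigD1 (Ordinal h2)) //= -e eqxx.
  by rewrite -addrA lerDl addr_ge0 // sumr_ge0 // => *; rewrite ?sumr_ge0.
rewrite exchange_big; apply: ler_sum => i _.
rewrite exchange_big; apply: ler_sum => m _ /=.
rewrite -big_mkcondr /=.
case: (ltnP (2 ^ i * m.*2.+1)%N N) => h; last first.
  rewrite big1 // => k /andP[_ /eqP e].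
  by move: (ltn_ord k); rewrite -e ltnNge h.
rewrite (bigD1 (Ordinal h)) /= ?eqxx ?muln_gt0 ?expn_gt0 // big1 ?addr0 //.
by move=> k /andP[/andP[_ /eqP e] /eqP []]; apply: val_inj.
Qed.

Lemma uweight_real (R : realType) e t : (uweight e t)%:R =
  (t`!)%:R * \sum_(j < t | uhalts e j t) j%:R^-1 :> R.
Proof.
rewrite /uweight natr_sum mulr_sumr [RHS]big_mkcond; apply: eq_bigr => j _ /=.
case: (uhalts e j t); rewrite ?mul0n // mul1n.
have [->|j0] := posnP j; first by rewrite divn0 invr0 mulr0.
have /dvdnP[q ->] : (j %| t`!)%N by rewrite dvdn_fact // j0 ltnW.
by rewrite mulnK // natrM mulfK // pnatr_eq0 -lt0n.
Qed.

Lemma accepted_index_sum (R : realType) i N :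
  \sum_(m < N | `[< exists t, uaccepts (2 ^ i * m.*2.+1)%N t >]) m%:R^-1 <=
  i%:R :> R.
Proof.
have [t h1 h2] := uaccepts_stage i N.
apply: (@le_trans _ _ (\sum_(m < t | uhalts i m t) m%:R^-1)).
  apply: (@ler_sum_ord R (fun m => m%:R^-1)
    (fun m => `[< exists t, uaccepts (2 ^ i * m.*2.+1)%N t >])
    (fun m => uhalts i m t) N t) => //.
  by move=> m hm /asboolP[s /(h2 m s hm)/and3P[_ -> ->]].
have f0 : 0 < (t`!)%:R :> R by rewrite ltr0n fact_gt0.
by rewrite -(ler_pM2l f0) -uweight_real -natrM ler_nat mulnC.
Qed.

Lemma sum_index_weights (R : realType) N :
  \sum_(i < N) (i%:R / 2 ^+ i.+1) <= 1 :> R.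
Proof.
suff -> : \sum_(i < N) (i%:R / 2 ^+ i.+1) = 1 - N.+1%:R / 2 ^+ N :> R.
  by rewrite gerBl divr_ge0 // exprn_ge0.
elim: N => [|N IH]; first by rewrite big_ord0 expr0 divr1 subrr.
have h : 2 ^+ N != 0 :> R by rewrite expf_neq0 // pnatr_eq0.
by rewrite big_ord_recr IH /= exprS; field.
Qed.

Lemma accepted_sum (R : realType) N :
  \sum_(k < N | (0 < k)%N && `[< exists t, uaccepts k t >]) k%:R^-1 <= 1 :> R.
Proof.
apply: le_trans (sum_index_weights R N).
rewrite big_mkcondr.
pose f k : R := if `[< exists t, uaccepts k t >] then k%:R^-1 else 0.
apply: le_trans (@sum_odd_part R f N _) _.
  by move=> k; rewrite /f; case: ifP.
apply: ler_sum => i _.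
(* Termwise, 1/(2^i (2m+1)) <= 1/(2^(i+1) m), where m > 0 by acceptance. *)
apply: (@le_trans _ _ ((2 ^+ i.+1)^-1 * \sum_(m < N |
    `[< exists t, uaccepts (2 ^ i * m.*2.+1)%N t >]) m%:R^-1)); last first.
  by rewrite mulrC ler_wpM2r ?accepted_index_sum // invr_ge0 exprn_ge0.
rewrite mulr_sumr [leRHS]big_mkcond; apply: ler_sum => m _.
rewrite /f; case: asboolP => // -[t].
rewrite uacceptsE => /and4P[m0 _ _ _].
rewrite -invfM lef_pV2 ?posrE; last 2 first.
- by rewrite ltr0n muln_gt0 expn_gt0.
- by rewrite mulr_gt0 ?ltr0n // exprn_gt0.
by rewrite -natrX -natrM ler_nat expnSr -mulnA leq_mul2l mul2n leqnSn orbT.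
Qed.

Theorem theorem26 (R : realType) :
  exists W : turing_machine,
    [/\ convergent R W, universal_for (convergent R) W & tuatara R W].
Proof.
have [c hc] := universal_program; set W := command_tm c.
have term0 (n : nat) : (0 <= (n%:R^-1 : R)%:E)%E by rewrite lee_fin.
have hW : (zeta R W <= 1)%E.
  apply: lime_le; first by apply: is_cvg_nneseries => n _ _.
  apply: nearW => N; rewrite (big_nat_widenl 1 0) // big_mkord sumEFin lee_fin.
  apply: le_trans (accepted_sum R N).
  apply: (@ler_sum_ord R (fun k => k%:R^-1)
    (fun k => (bin k \in dom W) && (0 < k)%N)
    (fun k => (0 < k)%N && `[< exists t, uaccepts k t >]) N N) => // k ->.
  move=> /andP[/set_mem hk k0]; rewrite k0 /=; apply/asboolP.
  by have [_] := hc (bin k); rewrite binK //; apply.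
exists W; split=> //.
  by rewrite /convergent (le_lt_trans hW) // ltry.
move=> C hC.
have hz : (0 <= zeta R C)%E by apply: nneseries_ge0 => n _ _.
pose z := fine (zeta R C).
have ez : zeta R C = z%:E.
  by rewrite /z fineK // ge0_fin_numE.
(* The padding exceeds z, and a pair is at least its first component, so z <= e. *)
pose e := machine_code C (Num.truncn z).+1.
have hze : z <= e%:R.
  apply: le_trans (ltW (truncnS_gt z)) _; rewrite ler_nat.
  by have [] := npair_ge (Num.truncn z).+1
    (npair (state_code (start C)) (table_code C)).
exists e.+1 => x /set_mem hx.
pose m := num x; pose n := (2 ^ e * m.*2.+1)%N.
have hm : bin m = x by exact: numK.
have n0 : (0 < n)%N by rewrite muln_gt0 expn_gt0.
have [h1 h2] := hc (bin n); rewrite binK // in h1 h2.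
have [t ht] : exists t, uaccepts n t.
  (* At this stage C has halted on x and m is below the stage; the weight divided by t! is bounded
     by a partial sum of zeta of C, hence by e. *)
  case: hx => t0 [k hk]; exists (maxn t0 m.+1).
  rewrite uacceptsE num_gt0 leq_maxr /=; apply/andP; split.
    by apply: uhalts_mono (leq_maxl _ _) _; rewrite uhalts_machine hm hk.
  set t := maxn _ _; rewrite -(ler_nat R) uweight_real natrM mulrC.
  apply: ler_wpM2r => //; apply: le_trans hze.
  rewrite -lee_fin -ez.
  apply: (@le_trans _ _ (\sum_(1 <= j < t | bin j \in dom C) (j%:R^-1)%:E)%E).
    rewrite (big_nat_widenl 1 0) // big_mkord sumEFin lee_fin.
    rewrite big_mkcond [leRHS]big_mkcond; apply: ler_sum => j _.
    have [->|j0] := posnP j; first by rewrite invr0 !if_same.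
    rewrite uhalts_machine andbT; case hj : (run t _) => [l|]; last first.
      by rewrite /=; case: ifP => _; rewrite ?invr_ge0 ?ler0n.
    by rewrite ifT //; apply/mem_set; exists t, l.
  by apply: nneseries_lim_ge.
(* W may answer at another stage t', but C has halted by then too, and its output does not depend on
   the stage. *)
have [t' ht' hcomp] := h1 t ht.
move: ht'; rewrite uacceptsE => /and4P[_ _ ht' _].
have [k hk] : exists k, run t' (Defs.init C x) = Some k.
  by move: ht'; rewrite uhalts_machine hm; case: run => // k; exists k.
have ho : digits_bits (uresult e m t') (uresult e m t') = output k.
  by apply: digits_bits_output; rewrite hm.
rewrite /= /n uindexE uargE ho in hcomp.
exists (bin n); split.
- by apply/mem_set; case: hcomp => l [k' [hl _]]; exists l, k'.
- rewrite size_bin_mul // -[m.*2.+1]addn1 (bin_double_add true) ?num_gt0 //.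
  by rewrite size_rcons hm; lia.
- by exists (output k); split=> //; exists t', k.
Qed.
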